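(* Let $f:\mathbb{R}^d\to\mathbb{R}$ be bounded below, Lipschitz continuous with constant $L_0>0$, and differentiable with Lipschitz continuous gradient with constant $L_1>0$. Run the zeroth-order iteration $x_{t+1}=x_t-\eta\,\tilde g(x_t)$ with one-point residual feedback (defined in the context) for $T\geq 1$ iterations with $\eta=\frac{1}{\widetilde L\,(d+4)^2\,T^{1/3}}$ and $\delta=\frac{1}{\sqrt d\,T^{1/3}}$, where $\widetilde L=\max(2L_0,32L_1)$, and let $\tilde x$ be selected uniformly at random from the $T$ iterates $x_0,\dots,x_{T-1}$ (independently of everything else). Then $$\mathbb{E}\big[\|\nabla f(\tilde x)\|^2\big]=\mathcal{O}\big(d^2\,T^{-2/3}\big).$$
   Context: Deterministic residual feedback: $x_0\in\mathbb{R}^d$ is a given deterministic point, $u_0,u_1,u_2,\dots$ are i.i.d. standard Gaussian vectors in $\mathbb{R}^d$, $\delta>0$ is the exploration parameter and $\eta>0$ the stepsize. For $t\ge 1$, $$\tilde g(x_t)=\frac{u_t}{\delta}\big(f(x_t+\delta u_t)-f(x_{t-1}+\delta u_{t-1})\big),$$ and at $t=0$, $\tilde g(x_0)=\frac{u_0}{\delta}f(x_0+\delta u_0)$. The iterates are $x_{t+1}=x_t-\eta\,\tilde g(x_t)$. Smoothed function: $f_\delta(x):=\mathbb{E}_{u}[f(x+\delta u)]$, with $u$ a standard Gaussian vector in $\mathbb{R}^d$. Meaning of $\mathcal{O}$: the left side is at most $C\,d^2T^{-2/3}$, where $C$ depends only on $L_0$, $L_1$, the initial gap $f_\delta(x_0)-\inf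 f_\delta$, and $\mathbb{E}[\|\tilde g(x_0)\|^2]$ (no further dependence on $d,T$). *)

(* Defs.v *)
From HB Require Import structures.
From mathcomp Require Import all_boot all_order all_algebra.
From mathcomp Require Import finmap.
From mathcomp Require Import all_classical all_reals all_analysis.
Set Implicit Arguments.
Unset Strict Implicit.
Unset Printing Implicit Defensive.
Import Order.TTheory GRing.Theory Num.Theory.
Import numFieldNormedType.Exports.
Local Open Scope classical_set_scope.
Local Open Scope ring_scope.

(* The library norm on 'rV[R]_d is the sup norm, hence an explicit Euclidean
   norm; the topology, and so [differentiable], is the same for both. *)
Definition norm2 (R : realType) (d : nat) (x : 'rV[R]_d) : R :=
  Num.sqrt (\sum_(i < d) x ord0 i ^+ 2).

Definition gradient (R : realType) (d : nat) (f : 'rV[R]_d -> R)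
    (x : 'rV[R]_d) : 'rV[R]_d :=
  \row_(i < d) 'D_(delta_mx ord0 i) f x.

Definition mutually_independent (R : realType) (disp : measure_display)
    (Omega : measurableType disp) (P : probability Omega R)
    (I : choiceType) (F : I -> set (set Omega)) : Prop :=
  forall (J : {fset I}) (A : I -> set Omega),
    (forall i, i \in J -> F i (A i)) ->
    P (\bigcap_(i in [set` J]) A i) = (\prod_(i <- J) P (A i))%E.

Definition independent (R : realType) (disp : measure_display)
    (Omega : measurableType disp) (P : probability Omega R)
    (F G : set (set Omega)) : Prop :=
  forall A B, F A -> G B -> P (A `&` B) = (P A * P B)%E.

(* There is no measurable structure on 'rV[R]_d in the library: a random vector
   is a function with measurable coordinates, and the sigma-algebra it generates
   is the one generated by its coordinates (the Borel sigma-algebra of R^d is the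
   product one). *)
Definition sigma_rV (R : realType) (Omega : Type) (d : nat)
    (U : Omega -> 'rV[R]_d) : set (set Omega) :=
  g_sigma_preimage (fun (i : 'I_d) w => U w ord0 i).

Definition sigma_seq (R : realType) (Omega : Type) (d : nat)
    (u : nat -> Omega -> 'rV[R]_d) : set (set Omega) :=
  <<s \bigcup_t sigma_rV (u t) >>.

Definition standard_gaussian (R : realType) (disp : measure_display)
    (Omega : measurableType disp) (P : probability Omega R) (d : nat)
    (U : Omega -> 'rV[R]_d) : Prop :=
  [/\ forall i : 'I_d, measurable_fun [set: Omega] (fun w => U w ord0 i),
      forall (i : 'I_d) (B : set R), measurable B ->
        P ((fun w => U w ord0 i) @^-1` B) = normal_prob 0 1 B
    & mutually_independent P (fun i : 'I_d =>
        preimage_set_system [set: Omega] (fun w => U w ord0 i) measurable)].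

Definition iid_standard_gaussian (R : realType) (disp : measure_display)
    (Omega : measurableType disp) (P : probability Omega R) (d : nat)
    (u : nat -> Omega -> 'rV[R]_d) : Prop :=
  (forall t, standard_gaussian P (u t)) /\
  mutually_independent P (fun t => sigma_rV (u t)).

Definition uniform_index (R : realType) (disp : measure_display)
    (Omega : measurableType disp) (P : probability Omega R) (T : nat)
    (tau : {RV P >-> nat}) : Prop :=
  forall k : nat,
    P (tau @^-1` [set k]) = (if (k < T)%N then T%:R^-1 else 0)%:E.

(* [U] is meant to be a standard Gaussian vector; the value depends only on its
   law. The expectation is finite when [f] is Lipschitz, so [fine] is harmless. *)
Definition smoothed (R : realType) (disp : measure_display)
    (Omega : measurableType disp) (P : probability Omega R) (d : nat)
    (U : Omega -> 'rV[R]_d) (f : 'rV[R]_d -> R) (delta : R)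
    (x : 'rV[R]_d) : R :=
  fine 'E_P[fun w => f (x + delta *: U w)].

Definition residual_feedback (R : realType) (Omega : Type) (d : nat)
    (f : 'rV[R]_d -> R) (delta : R) (u x : nat -> Omega -> 'rV[R]_d)
    (t : nat) (w : Omega) : 'rV[R]_d :=
  let y s := f (x s w + delta *: u s w) in
  (if t is s.+1 then (y t - y s) / delta else y 0%N / delta) *: u t w.

Definition residual_feedback_iterates (R : realType) (Omega : Type) (d : nat)
    (f : 'rV[R]_d -> R) (eta delta : R) (x0 : 'rV[R]_d)
    (u x : nat -> Omega -> 'rV[R]_d) : Prop :=
  (forall w, x 0%N w = x0) /\
  (forall t w, x t.+1 w = x t w - eta *: residual_feedback f delta u x t w).

(* Main.v *)
(** The gradient of the smoothed function is never needed. Let [v] be a Gaussian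
    vector independent of [u_0, .., u_t] (we take [v = u_T]) and apply the
    descent inequality to [f (. + delta v)] between [x_t] and [x_t+1]. Its linear
    term is [<grad f (x_t + delta v), g_t>]; integrating by parts in each
    coordinate of [u_t], all other coordinates being frozen, turns its
    expectation into that of [<grad f (x_t + delta v), grad f (x_t + delta u_t)>]:
    the previous query drops out, being independent of [u_t]. Both factors are
    within [L1 delta] times a Gaussian norm of [grad f (x_t)], so the expectation
    is at least [3/4 E|grad f (x_t)|^2 - 5 L1^2 delta^2 d].

    The second moments satisfy
    [E|g_t+1|^2 <= alpha E|g_t|^2 + 32 d^2 E|grad f (x_t)|^2 + 90 L1^2 delta^2 d^3]
    with [alpha <= 1/128], by comparing consecutive queries first through [L0]
    and the last step, then through a Taylor expansion at [x_t]. The chosen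
    stepsize makes the contribution of the gradients to [L1 eta^2/2 E|g_t|^2]
    smaller than [3/4 eta E|grad f (x_t)|^2], so they can be absorbed; all that
    remains is of order [d^2 T^(-2/3)]. Finally [|f_delta - f| <= L0] since
    [delta^2 d <= 1], which costs only a constant in the initial gap. *)

Require Import Defs.
From HB Require Import structures.
From mathcomp Require Import all_boot all_order all_algebra.
From mathcomp Require Import finmap ring lra.
From mathcomp Require Import all_classical all_reals all_analysis.
From mathcomp Require Import measurable_realfun.
Set Implicit Arguments.
Unset Strict Implicit.
Unset Printing Implicit Defensive.
Import Order.TTheory GRing.Theory Num.Theory.
Import numFieldNormedType.Exports.
Local Open Scope classical_set_scope.
Local Open Scope ring_scope.

(** * Real-valued integrable functions *)

Notation L1fun mu f := (mu.-integrable setT (EFin \o f)).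

Section real_integral.
Context d (T : measurableType d) (R : realType) (mu : {measure set T -> \bar R}).
Implicit Types f g : T -> R.

Lemma L1_measurable f : L1fun mu f -> measurable_fun setT f.
Proof. by move=> /measurable_int/measurable_EFinP. Qed.

Lemma L1_le f g : measurable_fun setT f -> (forall x, `|f x| <= g x) ->
  L1fun mu g -> L1fun mu f.
Proof.
move=> mf fg; apply: le_integrable => //; first exact/measurable_EFinP.
by move=> x _ /=; rewrite lee_fin (le_trans (fg x))// ler_norm.
Qed.

Lemma L1D f g : L1fun mu f -> L1fun mu g -> L1fun mu (fun x => f x + g x).
Proof. by move=> lf lg; apply: eq_integrable (integrableD _ lf lg). Qed.

Lemma L1B f g : L1fun mu f -> L1fun mu g -> L1fun mu (fun x => f x - g x).
Proof. by move=> lf lg; apply: eq_integrable (integrableB _ lf lg). Qed.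

Lemma L1Z k f : L1fun mu f -> L1fun mu (fun x => k * f x).
Proof. by move=> lf; apply: eq_integrable (integrableZl _ k lf). Qed.

Lemma L1_norm f : L1fun mu f -> L1fun mu (fun x => `|f x|).
Proof. by move=> lf; apply: eq_integrable (integrable_abse lf). Qed.

Lemma L1_sum n (f : 'I_n -> T -> R) : (forall i, L1fun mu (f i)) ->
  L1fun mu (fun x => \sum_(i < n) f i x).
Proof.
elim: n f => [|n IH] f lf.
  have -> : EFin \o (fun x => \sum_(i < 0) f i x) = cst 0%E.
    by apply/funext => x /=; rewrite big_ord0.
  exact: integrable0.
have := L1D (IH _ (fun i => lf (widen_ord (leqnSn n) i))) (lf ord_max).
congr (mu.-integrable _ _); apply/funext => x /=.
by rewrite big_ord_recr.
Qed.

Lemma integral_sum_L1 n (f : 'I_n -> T -> R) : (forall i, L1fun mu (f i)) ->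
  (\int[mu]_x (\sum_(i < n) f i x) = \sum_(i < n) \int[mu]_x f i x)%R.
Proof.
elim: n f => [|n IH] f lf.
  rewrite big_ord0; under eq_Rintegral do rewrite big_ord0.
  by rewrite Rintegral_cst// mul0r.
rewrite big_ord_recr/= -IH => [|i]; last exact: lf.
under eq_Rintegral do rewrite big_ord_recr/=.
by rewrite RintegralD//; exact: L1_sum.
Qed.

End real_integral.

(** * The standard normal law *)

Section gaussian.
Context {R : realType}.
Local Notation mu := (@lebesgue_measure R).
Local Notation N := (@normal_prob R 0 1).
Local Notation p := (@normal_pdf R 0 1).

(** The Radon-Nikodym derivative of [N] with respect to Lebesgue measure equals [p] almost
    everywhere, since both have the same integral over every measurable set. Integrals against [N]
    thus become Lebesgue integrals, to which calculus applies. *)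
Lemma ge0_integral_normal_prob (f : R -> \bar R) :
  measurable_fun setT f -> (forall z, 0 <= f z)%E ->
  (\int[N]_z f z = \int[mu]_z (f z * (p z)%:E))%E.
Proof.
move=> mf f0.
have dom := @normal_prob_dominates R 0 1.
rewrite -(Radon_Nikodym_SigmaFinite.change_of_variables dom) //=.
set RN := Radon_Nikodym_SigmaFinite.f _ _.
have mRN : measurable_fun setT RN.
  exact: measurable_int (Radon_Nikodym_SigmaFinite.f_integrable dom).
have mp : measurable_fun setT (fun z => (p z)%:E).
  by apply/measurable_EFinP; exact: measurable_normal_pdf.
apply: ae_eq_integral => //.
- exact: emeasurable_funM.
- exact: emeasurable_funM.
- apply: ae_eqe_mul2l; apply: integral_ae_eq => //.
    exact: Radon_Nikodym_SigmaFinite.f_integrable.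
  by move=> E _ mE; rewrite -Radon_Nikodym_SigmaFinite.f_integral.
Qed.

Lemma integrable_normal_prob (f : R -> R) : measurable_fun setT f ->
  mu.-integrable setT (fun z => (f z * p z)%:E) ->
  N.-integrable setT (EFin \o f).
Proof.
move=> mf /integrableP[_ fi]; apply/integrableP; split.
  exact/measurable_EFinP.
rewrite ge0_integral_normal_prob//.
- apply: le_lt_trans fi; rewrite le_eqVlt; apply/orP; left; apply/eqP.
  apply: eq_integral => z _ /=; rewrite normrM EFinM.
  by rewrite (ger0_norm (normal_pdf_ge0 _ _ _)).
- by apply: measurableT_comp => //; exact/measurable_EFinP.
Qed.

Lemma integrable_normal_prob_pdf (f : R -> R) :
  N.-integrable setT (EFin \o f) ->
  mu.-integrable setT (fun z => (f z * p z)%:E).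
Proof.
move=> /integrableP[/measurable_EFinP mf fi]; apply/integrableP; split.
  apply/measurable_EFinP; apply: measurable_funM => //.
  exact: measurable_normal_pdf.
apply: le_lt_trans fi; rewrite ge0_integral_normal_prob//.
- rewrite le_eqVlt; apply/orP; left; apply/eqP.
  apply: eq_integral => z _ /=; rewrite normrM EFinM.
  by rewrite (ger0_norm (normal_pdf_ge0 _ _ _)).
- by apply: measurableT_comp => //; exact/measurable_EFinP.
Qed.

Lemma integral_normal_prob (f : R -> R) : N.-integrable setT (EFin \o f) ->
  (\int[N]_z (f z)%:E = \int[mu]_z (f z * p z)%:E)%E.
Proof.
move=> fi; have mf := measurable_int _ fi.
rewrite integralE [RHS]integralE; congr (_ - _)%E.
- rewrite ge0_integral_normal_prob//; last exact: measurable_funepos.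
  apply: eq_integral => z _; rewrite !funeposE /= -EFin_max EFinM.
  by rewrite -!EFin_max -EFinM maxr_pMl ?normal_pdf_ge0 ?mul0r.
- rewrite ge0_integral_normal_prob//; last exact: measurable_funeneg.
  apply: eq_integral => z _; rewrite !funenegE /= -EFin_max.
  by rewrite -!EFin_max -EFinM maxr_pMl ?normal_pdf_ge0 ?mul0r ?mulNr.
Qed.

Lemma normal_pdf01E z : p z = normal_peak 1 * expR (- (z ^+ 2 / 2)).
Proof.
rewrite normal_pdfE ?oner_eq0//; congr (_ * expR _).
by rewrite subr0 expr1n mulNr.
Qed.

Lemma is_derive_normal_pdf (z : R) : is_derive z 1 p (- z * p z).
Proof.
have -> : p = fun z => normal_peak 1 * expR (- (z ^+ 2 / 2)).
  by apply/funext => y; exact: normal_pdf01E.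
apply: is_derive_eq.
by rewrite !scaler0 add0r /GRing.scale/=; field.
Qed.

(** Half of the Gaussian exponent pays for the power. With [w = z ^+ 2 / 4], the exponential series
    dominates [w ^+ k] divided by the factorial of [k], and [|z| ^+ k <= 4 ^+ k * w ^+ k] once
    [|z| > 1]. The summand [1] in the witness covers small [z] and [k = 0]. *)
Lemma expR_dominates_pow k : exists C : R, 0 <= C /\
  forall z, `|z| ^+ k * expR (- (z ^+ 2 / 2)) <= C * expR (- (z ^+ 2 / 4)).
Proof.
exists (4 ^+ k * k`!%:R + 1); split.
  by rewrite addr_ge0// mulr_ge0// exprn_ge0.
move=> z.
have -> : - (z ^+ 2 / 2) = - (z ^+ 2 / 4) + - (z ^+ 2 / 4) by field.
rewrite expRD mulrA ler_wpM2r ?expR_ge0// expRN ler_pdivrMr ?expR_gt0//.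
have w0 : 0 <= z ^+ 2 / 4 by rewrite divr_ge0// sqr_ge0.
have e1 : 1 <= (4 ^+ k * k`!%:R + 1) * expR (z ^+ 2 / 4).
  have e1 : 1 <= expR (z ^+ 2 / 4) by rewrite -[leLHS]expR0 ler_expR.
  apply: (le_trans e1); rewrite ler_peMl ?expR_ge0// lerDr.
  by rewrite mulr_ge0// exprn_ge0.
have [z1|z1] := leP `|z| 1.
  by apply: le_trans e1; rewrite exprn_ile1.
case: k e1 => [|k] e1; first by rewrite expr0.
have := expR_ge1Dxn k w0.
rewrite -ler_pdivrMl; last by rewrite ltr_pwDr// mulr_ge0// exprn_ge0.
apply: le_trans.
rewrite ler_pdivrMl; last by rewrite ltr_pwDr// mulr_ge0// exprn_ge0.
have H : `|z| ^+ k.+1 <= 4 ^+ k.+1 * (z ^+ 2 / 4) ^+ k.+1.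
  rewrite -exprMn mulrCA divff ?pnatr_eq0// mulr1.
  rewrite -[z ^+ 2]real_normK ?num_real//.
  rewrite lerXn2r ?nnegrE ?exprn_ge0//.
  by rewrite expr2 ler_peMr// ltW.
apply: (le_trans H).
set a := (4 ^+ _ : R); set b := (_ ^+ k.+1 : R).
have a0 : 0 <= a by rewrite exprn_ge0.
have b0 : 0 <= b by rewrite exprn_ge0.
have F0 : 0 < (k.+1`!%:R : R) by rewrite ltr0n fact_gt0.
have -> : (a * k.+1`!%:R + 1) * (1 + b / k.+1`!%:R) =
   a * b + (a * k.+1`!%:R + 1 + b / k.+1`!%:R) by field; rewrite gt_eqF.
rewrite lerDl !addr_ge0 ?divr_ge0 ?mulr_ge0// ltW//.
Qed.

Lemma L1_normal_powr k : L1fun N (fun z => `|z| ^+ k).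
Proof.
have [C [C0 HC]] := expR_dominates_pow k.
have mk : measurable_fun setT (fun z : R => `|z| ^+ k).
  by apply: measurable_funX; exact: normr_measurable.
apply: integrable_normal_prob => //.
(* With standard deviation [s2], the normal density is proportional to [expR (- (z ^+ 2 / 4))],
   which is exactly the dominating function. *)
pose s2 : R := Num.sqrt 2.
have s20 : s2 != 0 by rewrite gt_eqF// sqrtr_gt0.
pose A : R := normal_peak 1 * C / normal_peak s2.
have := @L1Z _ _ _ mu A _ (integrable_normal_pdf 0 s2).
apply: L1_le.
  by apply: measurable_funM => //; exact: measurable_normal_pdf.
move=> z; rewrite (normal_pdfE _ s20) normal_pdf01E /A.
have P0 : 0 < normal_peak s2 by exact: normal_peak_gt0.
have P1 := @normal_peak_ge0 R 1.
have -> : normal_peak 1 * C / normal_peak s2 *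
    (normal_peak s2 * normal_fun 0 s2 z) =
    normal_peak 1 * (C * expR (- (z ^+ 2 / 4))).
  have s24 : s2 ^+ 2 *+ 2 = 4 by rewrite sqr_sqrtr//; ring.
  rewrite /normal_fun subr0 s24 mulNr.
  by field; rewrite gt_eqF.
rewrite normrM normrX normr_id normrM (ger0_norm P1) (ger0_norm (expR_ge0 _)).
by rewrite mulrCA ler_wpM2l.
Qed.

Lemma L1_normal_growth (K : R) k (f : R -> R) : measurable_fun setT f ->
  (forall z, `|f z| <= K * (1 + `|z| ^+ k)) -> L1fun N f.
Proof.
move=> mf fK; apply: (@L1_le _ _ _ N f (fun z => K * (1 + `|z| ^+ k))) => //.
apply: L1Z; apply: L1D; last exact: L1_normal_powr.
exact: finite_measure_integrable_cst.
Qed.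

Lemma L1_normal_growthM (K : R) k (phi : R -> R) : measurable_fun setT phi ->
  (forall z, `|phi z| <= K * (1 + `|z| ^+ k)) ->
  L1fun N (fun z => z * phi z).
Proof.
move=> mphi gphi; apply: (@L1_normal_growth (2 * K) k.+1).
  by apply: measurable_funM.
have K0 : 0 <= K.
  by have := le_trans (normr_ge0 _) (gphi 0); rewrite pmulr_lge0.
move=> z; rewrite normrM.
apply: (le_trans (ler_wpM2l (normr_ge0 _) (gphi z))).
rewrite mulrCA [2 * K]mulrC -mulrA ler_wpM2l// mulrDr mulr1 -exprS.
rewrite mulrDr mulr1 [leRHS]addrC mulr2n mulrDl mul1r -addrA [leRHS]addrC.
have [z1|z1] := leP `|z| 1.
  have : 0 <= `|z| ^+ k.+1 by rewrite exprn_ge0.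
  lra.
have : `|z| <= `|z| ^+ k.+1 by rewrite exprS ler_peMr// exprn_ege1// ltW.
lra.
Qed.

(** The extra factor [|z|] is there to give the boundary terms of an integration by parts a decay of
    order [1 / |z|]. *)
Lemma normal_pdf_decay k : exists C : R, 0 <= C /\
  forall z, `|z| * (1 + `|z| ^+ k) * p z <= C.
Proof.
have [C1 [C10 H1]] := expR_dominates_pow 1.
have [Ck [Ck0 Hk]] := expR_dominates_pow k.+1.
have P1 := @normal_peak_ge0 R 1.
exists (normal_peak 1 * (C1 + Ck)); split; first by rewrite mulr_ge0// addr_ge0.
move=> z; rewrite normal_pdf01E mulrCA ler_wpM2l//.
rewrite mulrDr mulr1 mulrDl -exprS.
have E1 : expR (- (z ^+ 2 / 4)) <= 1.
  by rewrite -[leRHS]expR0 ler_expR oppr_le0 divr_ge0// sqr_ge0.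
apply: lerD.
  by have := H1 z; rewrite expr1 => /le_trans; apply; rewrite ler_piMr.
by apply: (le_trans (Hk z)); rewrite ler_piMr.
Qed.

(** Since the derivative of [p] is [- z * p z], the function [(z * phi z - dphi z) * p z] has the
    primitive [F = - phi * p]. Its integral over growing symmetric intervals is a difference of
    boundary values of [F], which tends to zero. *)
Lemma stein (phi dphi : R -> R) (K : R) (k : nat) :
  (forall z : R, is_derive z 1 phi (dphi z)) -> continuous dphi ->
  (forall z, `|phi z| <= K * (1 + `|z| ^+ k)) ->
  (forall z, `|dphi z| <= K * (1 + `|z| ^+ k)) ->
  (\int[N]_z (z * phi z) = \int[N]_z dphi z)%R.
Proof.
move=> dP cd gphi gdphi.
have cphi : continuous phi.
  move=> z; apply: differentiable_continuous.
  by apply/derivable1_diffP; apply: ex_derive.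
have mphi : measurable_fun setT phi by exact: continuous_measurable_fun.
have mdphi : measurable_fun setT dphi by exact: continuous_measurable_fun.
have K0 : 0 <= K.
  have := le_trans (normr_ge0 _) (gphi 0); rewrite pmulr_lge0//.
have L1d : L1fun N dphi by exact: L1_normal_growth gdphi.
have L1z : L1fun N (fun z => z * phi z) by exact: L1_normal_growthM gphi.
apply/eqP; rewrite -subr_eq0 -RintegralB//; apply/eqP.
pose g z := (z * phi z - dphi z).
have L1g : L1fun N g by exact: L1B.
rewrite /Rintegral integral_normal_prob//.
suff -> : (\int[mu]_z (g z * p z)%:E = 0)%E by [].
have ig := integrable_normal_prob_pdf L1g.
pose I n : set R := `[- n.+1%:R, n.+1%:R]%classic.
pose F z := - (phi z * p z).
have dF (z : R) : is_derive z 1 F (g z * p z).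
  have := is_derive_normal_pdf z; have := dP z => h1 h2.
  apply: is_derive_eq; rewrite /GRing.scale/= /g; ring.
have cp : continuous p by apply: continuous_normal_pdf; exact: oner_neq0.
have cF : continuous F.
  move=> z; apply: differentiable_continuous.
  by apply/derivable1_diffP; apply: ex_derive.
have cg : continuous (fun z => g z * p z).
  move=> z; apply: cvgM; last exact: cp.
  by apply: cvgB; [apply: cvgM => //; exact: cphi|exact: cd].
have [C [C0 HC]] := normal_pdf_decay k.
have HF z : `|z| * `|F z| <= K * C.
  rewrite /F normrN normrM (ger0_norm (normal_pdf_ge0 _ _ _)).
  rewrite mulrA; apply: (@le_trans _ _ (K * (`|z| * (1 + `|z| ^+ k) * p z))).
    rewrite mulrA ler_wpM2r ?normal_pdf_ge0// mulrCA.
    by rewrite ler_wpM2l.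
  by rewrite ler_wpM2l.
have n0 n : 0 < (n.+1%:R : R) by rewrite ltr0n.
have JE n : (\int[mu]_(z in I n) (g z * p z)%:E =
    (F n.+1%:R - F (- n.+1%:R))%:E)%E.
  rewrite EFinB; apply: continuous_FTC2.
  - by rewrite gtrN.
  - exact: continuous_subspaceT.
  - split.
    + by move=> z _; apply: ex_derive.
    + exact/cvg_at_right_filter/cF.
    + exact/cvg_at_left_filter/cF.
  - by move=> z _; rewrite derive1E derive_val.
(* Dominated convergence, the dominating function being the absolute value of the integrand
   itself. *)
have cvg1 : (\int[mu]_(z in I n) (g z * p z)%:E @[n --> \oo] -->
    \int[mu]_z (g z * p z)%:E)%E.
  under eq_fun do rewrite integral_mkcond.
  apply: (@dominated_cvg _ _ _ mu setT measurableT
    (fun n => (fun z => (g z * p z)%:E) \_ (I n)) (fun z => (g z * p z)%:E)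
    (fun z => `|g z * p z|%:E)) => //.
  - move=> n; apply/(measurable_restrictT _ _).1 => //.
      exact: measurable_itv.
    by apply: measurable_funTS; exact: measurable_int ig.
  - move=> z _; apply: cvg_near_cst.
    near=> n; rewrite patchE mem_set// /I /= in_itv/= -ler_norml.
    near: n; exists (Num.truncn `|z|) => // n /= zn.
    apply/ltW/(lt_le_trans (truncnS_gt _)).
    by rewrite ler_nat ltnS.
  - by apply: eq_integrable (integrable_abse ig).
  - move=> n z _; rewrite patchE; case: ifP => _ //.
    by rewrite abse0 lee_fin.
have cvg0 : (\int[mu]_(z in I n) (g z * p z)%:E @[n --> \oo] --> 0%:E)%E.
  under eq_fun do rewrite JE.
  apply: cvg_EFin; first by near=> n.
  apply: norm_cvg0.
  apply: (@squeeze_cvgr _ _ _ _ (cst 0) (fun n => 2 * K * C * n.+1%:R^-1)).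
  - near=> n; rewrite normr_ge0/=.
    rewrite ler_pdivlMr// mulrC.
    apply: (le_trans (ler_wpM2l (ltW (n0 n)) (ler_normB _ _))).
    have := HF n.+1%:R; have := HF (- n.+1%:R).
    rewrite normrN (gtr0_norm (n0 n)); lra.
  - exact: cvg_cst.
  - rewrite -(mulr0 (2 * K * C)); apply: cvgMr; exact: cvg_harmonic.
exact: (cvg_unique _ cvg1 cvg0).
Unshelve. all: by end_near. Qed.

(** Stein's identity for the monomial [z ^+ k.+1]; the growth constant [k.+1] serves the monomial
    and its derivative alike. *)
Lemma normal_moment_rec k :
  (\int[N]_z (z ^+ k.+2) = k.+1%:R * \int[N]_z (z ^+ k))%R.
Proof.
have Lk : L1fun N (fun z => z ^+ k).
  apply: (@L1_le _ _ _ N _ (fun z => `|z| ^+ k)); last exact: L1_normal_powr.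
    exact: measurable_funX.
  by move=> z; rewrite normrX.
rewrite -RintegralZl//.
under eq_Rintegral do rewrite exprS.
apply: (@stein _ _ k.+1%:R k.+1).
- move=> z; apply: DeriveDef; first exact: exprn_derivable.
  by rewrite exp_derive /GRing.scale/= mulr1.
- move=> z; apply: cvgM; first exact: cvg_cst.
  exact: exprn_continuous.
- move=> z; rewrite normrX -[leLHS]mul1r ler_pM//.
    by rewrite ler1n.
  by rewrite lerDr.
- move=> z; rewrite normrM normrX ger0_norm// ler_wpM2l//.
  have [z1|z1] := leP `|z| 1.
    by rewrite (@le_trans _ _ 1) ?exprn_ile1// lerDl exprn_ge0.
  by rewrite (@le_trans _ _ (`|z| ^+ k.+1)) ?lerDr// ler_weXn2l// ltW.
Qed.

Lemma normal_moment2 : (\int[N]_z (z ^+ 2) = 1)%R.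
Proof.
rewrite normal_moment_rec; under eq_Rintegral do rewrite expr0.
by rewrite Rintegral_cst//= /normal_prob integral_normal_pdf /= !mulr1.
Qed.

Lemma normal_moment4 : (\int[N]_z (z ^+ 4) = 3)%R.
Proof. by rewrite normal_moment_rec normal_moment2 mulr1. Qed.

Lemma normal_moment6 : (\int[N]_z (z ^+ 6) = 15)%R.
Proof. by rewrite normal_moment_rec normal_moment4 -natrM. Qed.

End gaussian.

(** * Euclidean norm and gradients *)

Definition dot (R : realType) (d : nat) (x y : 'rV[R]_d) : R :=
  \sum_(i < d) x ord0 i * y ord0 i.

Notation sqn x := (dot x x).

Section euclid.
Context {R : realType} {d : nat}.
Implicit Types x y z : 'rV[R]_d.

Lemma dotC x y : dot x y = dot y x.
Proof. by apply: eq_bigr => i _; rewrite mulrC. Qed.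

Lemma dotDl x y z : dot (x + y) z = dot x z + dot y z.
Proof.
by rewrite -big_split/=; apply: eq_bigr => i _; rewrite mxE mulrDl.
Qed.

Lemma dotZl k x z : dot (k *: x) z = k * dot x z.
Proof.
by rewrite mulr_sumr; apply: eq_bigr => i _; rewrite mxE mulrA.
Qed.

Lemma dotDr x y z : dot z (x + y) = dot z x + dot z y.
Proof. by rewrite dotC dotDl !(dotC z). Qed.

Lemma dotZr k x z : dot z (k *: x) = k * dot z x.
Proof. by rewrite dotC dotZl (dotC z). Qed.

Lemma dotNl x z : dot (- x) z = - dot x z.
Proof. by rewrite -scaleN1r dotZl mulN1r. Qed.

Lemma dotNr x z : dot z (- x) = - dot z x.
Proof. by rewrite dotC dotNl (dotC z). Qed.

Definition dotE := (dotDl, dotDr, dotNl, dotNr, dotZl, dotZr).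

Lemma sqnE x : sqn x = \sum_(i < d) x ord0 i ^+ 2.
Proof. by apply: eq_bigr => i _; rewrite expr2. Qed.

Lemma sqn_ge0 x : 0 <= sqn x.
Proof. by rewrite sqnE sumr_ge0// => i _; exact: sqr_ge0. Qed.

Lemma norm2_ge0 x : 0 <= norm2 x.
Proof. exact: sqrtr_ge0. Qed.

Lemma sqr_norm2 x : norm2 x ^+ 2 = sqn x.
Proof.
rewrite sqnE /norm2 sqr_sqrtr// sumr_ge0// => i _; exact: sqr_ge0.
Qed.

Lemma norm2_sqrt x : norm2 x = Num.sqrt (sqn x).
Proof. by rewrite sqnE. Qed.

Lemma norm2Z k x : norm2 (k *: x) = `|k| * norm2 x.
Proof.
by rewrite !norm2_sqrt !dotE mulrA -expr2 sqrtrM ?sqr_ge0// sqrtr_sqr.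
Qed.

Lemma norm2N x : norm2 (- x) = norm2 x.
Proof. by rewrite -scaleN1r norm2Z normrN1 mul1r. Qed.

Lemma ge_coord_norm2 x i : `|x ord0 i| <= norm2 x.
Proof.
rewrite -sqrtr_sqr ler_wsqrtr// (bigD1 i)//= lerDl sumr_ge0// => j _.
exact: sqr_ge0.
Qed.

(** Cauchy-Schwarz: the squared norm of [sqn y *: x - dot x y *: y] factors as [sqn y] times the
    difference of the two sides. *)
Lemma dot_sqr_le x y : dot x y ^+ 2 <= sqn x * sqn y.
Proof.
have [y0|y0] := eqVneq (sqn y) 0.
  suff -> : dot x y = 0 by rewrite y0 expr0n mulr0.
  apply: big1 => i _.
  have : y ord0 i == 0.
    rewrite -normr_le0 (le_trans (ge_coord_norm2 _ _))//.
    by rewrite norm2_sqrt y0 sqrtr0.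
  by move/eqP ->; rewrite mulr0.
have yp : 0 < sqn y by rewrite lt_neqAle eq_sym y0 sqn_ge0.
have := sqn_ge0 (sqn y *: x - dot x y *: y).
have -> : sqn (sqn y *: x - dot x y *: y) =
   sqn y * (sqn x * sqn y - dot x y ^+ 2) by rewrite !dotE (dotC y x); ring.
by rewrite pmulr_rge0// subr_ge0.
Qed.

Lemma dot_le x y : `|dot x y| <= norm2 x * norm2 y.
Proof.
rewrite !norm2_sqrt -sqrtrM ?sqn_ge0// -sqrtr_sqr ler_wsqrtr//.
exact: dot_sqr_le.
Qed.

(** Young's inequality: the nonnegativity of [sqn (2^-1 *: x + (r + s))] charges a quarter of
    [sqn x] for the terms linear in [x]. What is left involves only [r] and [s], and [5 / 2] is a
    generous constant for it. *)
Lemma dot_perturb_ge x r s :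
  3 / 4 * sqn x - 5 / 2 * (sqn r + sqn s) <= dot (x + r) (x + s).
Proof.
have h1 := sqn_ge0 (2^-1 *: x + (r + s)).
have h2 := sqn_ge0 (r - s).
have h3 := sqn_ge0 (r + s).
move: h1 h2 h3; rewrite !dotE (dotC r x) (dotC s x) (dotC s r).
lra.
Qed.

End euclid.

Section gradient.
Context {R : realType} {d : nat} (f : 'rV[R]_d -> R).
Hypothesis df : forall y, differentiable f y.
Implicit Types x h : 'rV[R]_d.

Lemma derive_gradient x h : 'D_h f x = dot (gradient f x) h.
Proof.
rewrite deriveE//.
have {1}-> : h = \sum_(i < d) h ord0 i *: delta_mx ord0 i.
  exact: row_sum_delta.
rewrite linear_sum; apply: eq_bigr => i _.
by rewrite linearZ/= -deriveE// mxE mulrC.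
Qed.

Lemma is_derive_line x h (s : R) :
  is_derive s 1 (fun r => f (x + r *: h)) (dot (gradient f (x + s *: h)) h).
Proof.
have E : (fun k : R => k^-1 *: (((fun r => f (x + r *: h)) \o shift s) (k *: 1)
      - f (x + s *: h))) =
    (fun k => k^-1 *: ((f \o shift (x + s *: h)) (k *: h) - f (x + s *: h))).
  apply/funext => k /=; congr (_ *: (f _ - _)).
  have -> : k *: (1 : R) = k by rewrite /GRing.scale/= mulr1.
  by rewrite scalerDl addrCA.
apply: DeriveDef.
  by rewrite /derivable E; exact: diff_derivable.
by rewrite /derive E -derive_gradient.
Qed.

Variable L : R.
Hypothesis Lf : forall y z,
  norm2 (gradient f y - gradient f z) <= L * norm2 (y - z).

(** The mean value theorem is applied to the signed remainder along the segment, minus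
    [L / 2 * sqn h * s ^+ 2]. This difference has a nonpositive derivative because the gradient is
    Lipschitz, so no integral remainder is needed. *)
Lemma taylor_bound x h :
  `|f (x + h) - f x - dot (gradient f x) h| <= L / 2 * sqn h.
Proof.
(* The sign [e] proves the upper and the lower bound at once. *)
suff H (e : R) : e ^+ 2 = 1 ->
    e * (f (x + h) - f x - dot (gradient f x) h) <= L / 2 * sqn h.
  rewrite ler_norml; apply/andP; split.
    have := H (-1); rewrite sqrrN expr1n mulN1r lerNl; exact.
  by have := H 1; rewrite expr1n mul1r; exact.
move=> e1.
pose c := dot (gradient f x) h.
pose g (s : R) := e * (f (x + s *: h) - s * c) - L / 2 * sqn h * s ^+ 2.
pose dg (s : R) := e * (dot (gradient f (x + s *: h)) h - c) - L * sqn h * s.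
have dgP (s : R) : is_derive s 1 g (dg s).
  have := is_derive_line x h s => h1; apply: is_derive_eq.
  by rewrite scaler0 add0r /GRing.scale/= /dg; field.
have cg : {within `[0, 1], continuous g}.
  apply: continuous_subspaceT => z; apply: differentiable_continuous.
  by apply/derivable1_diffP; apply: ex_derive.
have [r /[!in_itv]/= /andP[r0 r1]] := MVT ltr01 (fun z _ => dgP z) cg.
rewrite /g scale1r scale0r addr0 mul1r mul0r expr0n expr1n/= !mulr0 !subr0 !mulr1.
have : dg r <= 0.
  rewrite /dg subr_le0 /c -[_ - _]/(dot _ _ + - dot _ _) -dotNl -dotDl.
  apply: (le_trans (ler_norm _)); rewrite normrM.
  have -> : `|e| = 1 by apply/eqP; rewrite -sqrp_eq1// -normrX e1 normr1.
  rewrite mul1r; apply: (le_trans (dot_le _ _)).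
  apply: (le_trans (ler_wpM2r (norm2_ge0 _) (Lf _ _))).
  rewrite addrAC subrr add0r norm2Z gtr0_norm// -sqr_norm2.
  by rewrite expr2 -!mulrA mulrCA (mulrC r) !mulrA.
rewrite /c; lra.
Qed.

Lemma gradient_coord_lip i y z :
  `|gradient f y ord0 i - gradient f z ord0 i| <= L * norm2 (y - z).
Proof.
have := ge_coord_norm2 (gradient f y - gradient f z) i.
by rewrite !mxE => /le_trans; apply; exact: Lf.
Qed.

Variable L' : R.
Hypothesis Lf' : forall y z, `|f y - f z| <= L' * norm2 (y - z).

(** A Taylor expansion over a unit step along the [i]-th axis. The constant is not sharp, but it
    serves integrability only and never enters the rate. *)
Lemma gradient_coord_bound i y : `|gradient f y ord0 i| <= L' + L / 2.
Proof.
pose h : 'rV[R]_d := delta_mx ord0 i.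
have hE j : h ord0 j = (j == i)%:R by rewrite mxE eqxx.
have Hd z : dot z h = z ord0 i.
  rewrite /dot (bigD1 i)//= hE eqxx mulr1 big1 ?addr0// => j ji.
  by rewrite hE (negbTE ji) mulr0.
have Hs : sqn h = 1 by rewrite Hd hE eqxx.
have := taylor_bound y h; rewrite Hd Hs mulr1 => H1.
have := Lf' (y + h) y.
rewrite addrAC subrr add0r norm2_sqrt Hs sqrtr1 mulr1 => H2.
have -> : gradient f y ord0 i = (f (y + h) - f y) -
  (f (y + h) - f y - gradient f y ord0 i) by ring.
by apply: (le_trans (ler_normB _ _)); exact: lerD.
Qed.

End gradient.

(** * Measurability of Lipschitz functions of a random vector *)

Section measurable_rV.
Context disp (T : measurableType disp) (R : realType) (d : nat).
Implicit Types U V : T -> 'rV[R]_d.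

Definition measurable_rV U :=
  forall i, measurable_fun setT (fun w => U w ord0 i).

Lemma measurable_rV_cst x : measurable_rV (fun=> x).
Proof. by move=> i. Qed.

Lemma measurable_rVD U V : measurable_rV U -> measurable_rV V ->
  measurable_rV (fun w => U w + V w).
Proof.
move=> mU mV i; under eq_fun do rewrite mxE; exact: measurable_funD.
Qed.

Lemma measurable_rVZ (g : T -> R) U : measurable_fun setT g ->
  measurable_rV U -> measurable_rV (fun w => g w *: U w).
Proof.
move=> mg mU i; under eq_fun do rewrite mxE; exact: measurable_funM.
Qed.

Lemma measurable_dot U V : measurable_rV U -> measurable_rV V ->
  measurable_fun setT (fun w => dot (U w) (V w)).
Proof. by move=> mU mV; apply: measurable_sum => i; exact: measurable_funM. Qed.

Lemma norm2_le_coord (x : 'rV[R]_d) e : 0 <= e ->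
  (forall i, `|x ord0 i| <= e) -> norm2 x <= d%:R * e.
Proof.
move=> e0 xe.
have -> : d%:R * e = Num.sqrt ((d%:R * e) ^+ 2).
  by rewrite sqrtr_sqr ger0_norm// mulr_ge0.
rewrite norm2_sqrt ler_wsqrtr// sqnE.
apply: (@le_trans _ _ (\sum_(i < d) e ^+ 2)).
  by apply: ler_sum => i _; rewrite -real_normK ?num_real// lerXn2r ?nnegrE.
rewrite sumr_const card_ord exprMn -[leLHS]mulr_natl ler_wpM2r ?sqr_ge0//.
rewrite -natrX ler_nat; case: d => // n; rewrite expnS leq_pmulr//.
Qed.

(* A Lipschitz function is the infimum of the countable family of cones
   [F q + K * norm2 (y - q)], [q] rational. *)
Lemma measurable_lipschitz_comp (F : 'rV[R]_d -> R) K U :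
  (forall y z, `|F y - F z| <= K * norm2 (y - z)) -> measurable_rV U ->
  measurable_fun setT (fun w => F (U w)).
Proof.
wlog K0 : K / 0 <= K => [wl|] lipF mU.
  apply: (wl `|K|) => // y z; apply: (le_trans (lipF y z)).
  by rewrite ler_wpM2r ?norm2_ge0// ler_norm.
pose rq (q : 'rV[rat]_d) : 'rV[R]_d := map_mx ratr q.
have mcone q : measurable_fun setT (fun w => F (rq q) + K * norm2 (U w - rq q)).
  apply: measurable_funD => //; apply: measurable_funM => //.
  under eq_fun do rewrite norm2_sqrt.
  have msqrt : measurable_fun setT (@Num.sqrt R).
    by apply: continuous_measurable_fun; exact: sqrt_continuous.
  apply: (measurableT_comp msqrt).
  by apply: measurable_dot; apply: measurable_rVD => //; exact: measurable_rV_cst.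
apply: (measurability _ (RGenInftyO.measurableE R)) => // _ [_ [a ->] <-].
rewrite setTI (_ : _ @^-1` _ = \bigcup_(q in [set: 'rV[rat]_d])
    [set w | F (rq q) + K * norm2 (U w - rq q) < a]); last first.
  apply/seteqP; split => [w|w [q _]] /=; rewrite in_itv/=; last first.
    apply: le_lt_trans; rewrite -lerBlDl (le_trans (ler_norm _))//.
  (* A rational point within [e] of [U w] in every coordinate costs at most [K * (d%:R * e)], once
     in the value of [F] and once in the cone, whence the factor [2]. The summand [1] keeps the
     denominator positive when [K = 0]. *)
  move=> Fa; pose e := (a - F (U w)) / (2 * (K * d%:R + 1)).
  have D0 : 0 < K * d%:R + 1 by rewrite ltr_wpDl// mulr_ge0.
  have e0 : 0 < e by rewrite divr_gt0 ?subr_gt0// mulr_gt0.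
  have /all_sig[q qe] : forall i, {q : rat | `|U w ord0 i - ratr q| <= e}.
    move=> i; apply: cid.
    have /rat_in_itvoo[q] : U w ord0 i - e < U w ord0 i + e by lra.
    rewrite in_itv/= => /andP[q1 q2]; exists q.
    by rewrite ler_norml; apply/andP; split; lra.
  exists (\row_i q i) => //.
  have n : norm2 (U w - rq (\row_i q i)) <= d%:R * e.
    by apply: norm2_le_coord => [|i]; [exact: ltW|rewrite !mxE; exact: qe].
  have := lipF (rq (\row_i q i)) (U w); rewrite ler_norml => /andP[_].
  have -> : norm2 (rq (\row_i q i) - U w) = norm2 (U w - rq (\row_i q i)).
    by rewrite -opprB norm2N.
  have : K * norm2 (U w - rq (\row_i q i)) <= K * (d%:R * e).
    by rewrite ler_wpM2l.
  have : 2 * (K * (d%:R * e)) < a - F (U w).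
    have -> : a - F (U w) = 2 * (K * d%:R + 1) * e.
      by rewrite /e mulrCA divff ?mulr1// gt_eqF// mulr_gt0.
    have -> : 2 * (K * d%:R + 1) * e = 2 * (K * (d%:R * e)) + 2 * e by ring.
    by rewrite ltrDl mulr_gt0.
  rewrite /=; lra.
apply: countable_bigcupT_measurable => [|q]; first exact: countableP.
rewrite -[X in measurable X]setTI.
by apply: (measurable_fun_ltr (mcone q) (measurable_cst a)) => //.
Qed.

End measurable_rV.

(** * Integration over an independent pair *)

Section independent_pair.
Context d1 d2 d3 (Omega : measurableType d1) (S : measurableType d2)
  (T : measurableType d3) (R : realType).
Context (P : probability Omega R) (Q : probability S R).
Context (W : Omega -> T) (Z : Omega -> S).
Hypothesis mW : measurable_fun setT W.
Hypothesis mZ : measurable_fun setT Z.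
Hypothesis indep : forall A B, measurable A -> measurable B ->
  (P (W @^-1` A `&` Z @^-1` B) = P (W @^-1` A) * Q B)%E.

Let W' : {mfun Omega >-> T} := mfun_Sub (mem_set mW).

Let WZ w := (W w, Z w).

Let mWZ : measurable_fun setT WZ.
Proof. by apply/measurable_fun_pairP. Qed.

Let WZ' : {mfun Omega >-> (T * S)%type} := mfun_Sub (mem_set mWZ).

Let law_pair X : measurable X ->
  (distribution P W' \x Q)%E X = distribution P WZ' X.
Proof.
apply: product_measure_unique => A B mA mB.
by rewrite -indep.
Qed.

(** The law of the pair is a product measure, so Tonelli applies after a change of variables. In
    later uses [T] is mostly [Omega] with a coarser sigma-algebra and [W] the identity, so that
    integrating over [z] amounts to conditioning on that sigma-algebra. *)
Lemma tonelli_independent (h : T * S -> \bar R) :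
  measurable_fun setT h -> (forall x, 0 <= h x)%E ->
  (\int[P]_w h (W w, Z w) = \int[P]_w \int[Q]_z h (W w, z))%E.
Proof.
move=> mh h0.
transitivity (\int[distribution P WZ']_x h x)%E.
  by rewrite ge0_integral_distribution.
rewrite (eq_measure_integral (distribution P W' \x Q)%E); last first.
  by move=> A mA _; apply/esym; exact: law_pair.
rewrite fubini_tonelli1// ge0_integral_distribution//.
- exact: measurable_fun_fubini_tonelli_F.
- by move=> x; exact: integral_ge0.
Qed.

Lemma L1_independent (h : T * S -> R) : measurable_fun setT h ->
  (\int[P]_w \int[Q]_z `|h (W w, z)|%:E < +oo)%E ->
  L1fun P (fun w => h (W w, Z w)).
Proof.
move=> mh hoo; apply/integrableP; split.
  by apply/measurable_EFinP; exact: measurableT_comp.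
rewrite (tonelli_independent (h := fun x => `|h x|%:E))//.
by apply/measurable_EFinP; exact: measurableT_comp.
Qed.

Lemma fubini_independent (h : T * S -> R) : measurable_fun setT h ->
  (forall x, L1fun Q (fun z => h (x, z))) ->
  L1fun P (fun w => h (W w, Z w)) ->
  (\int[P]_w h (W w, Z w) = \int[P]_w \int[Q]_z h (W w, z))%R.
Proof.
move=> mh hQ hi.
have hE : (distribution P W' \x Q)%E.-integrable setT (EFin \o h).
  apply/integrableP; split; first exact/measurable_EFinP.
  rewrite (eq_measure_integral (distribution P WZ')); last first.
    by move=> A mA _; exact: law_pair.
  rewrite ge0_integral_distribution//.
    by move/integrableP : hi => [].
  by apply: measurableT_comp => //; exact/measurable_EFinP.
rewrite {1}/Rintegral.
transitivity (fine (\int[distribution P WZ']_x (h x)%:E)%E).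
  by rewrite integral_distribution//; exact/measurable_EFinP.
rewrite (eq_measure_integral (distribution P W' \x Q)%E); last first.
  by move=> A mA _; apply/esym; exact: law_pair.
rewrite -integral12_prod_meas1//.
rewrite /Rintegral integral_distribution.
(* Integrability for every frozen [x] makes each inner integral finite, so [fine] loses nothing
   inside. *)
- congr fine; apply: eq_integral => w _ /=; rewrite /fubini_F fineK//.
  exact: integrable_fin_num (hQ (W w)).
- exact: measurable_fubini_F hE.
- have /integrableP[mF iF] := integrable_fubini_F hE.
  apply/integrableP; split; first exact: measurableT_comp.
  by move: iF; rewrite ge0_integral_distribution//; exact: measurableT_comp.
Qed.

Lemma L1M_independent (X : T -> R) (g : S -> R) :
  measurable_fun setT X -> L1fun P (X \o W) -> L1fun Q g ->
  L1fun P (fun w => X (W w) * g (Z w)).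
Proof.
move=> mX iX ig; have mg := L1_measurable ig.
apply: (L1_independent (h := fun x => X x.1 * g x.2)) => /=.
  by apply: measurable_funM; exact: measurableT_comp.
under eq_integral => w _.
  under eq_integral do rewrite normrM EFinM.
  rewrite ge0_integralZl//; last first.
    by apply/measurable_EFinP; exact: measurableT_comp.
  over.
rewrite /= ge0_integralZr//.
- apply: lte_mul_pinfty => //.
  + exact: integral_ge0.
  + rewrite ge0_fin_numE; last exact: integral_ge0.
    by move/integrableP : iX => [].
  + by move/integrableP : ig => [].
- by move/L1_measurable : iX => iX; apply/measurable_EFinP; exact: measurableT_comp.
- exact: integral_ge0.
Qed.

Lemma integralM_independent (X : T -> R) (g : S -> R) :
  measurable_fun setT X -> L1fun P (X \o W) -> L1fun Q g ->
  (\int[P]_w (X (W w) * g (Z w)) = (\int[P]_w X (W w)) * \int[Q]_z g z)%R.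
Proof.
move=> mX iX ig; have mg := L1_measurable ig.
rewrite (fubini_independent (h := fun x => X x.1 * g x.2)) /=; last 3 first.
- by apply: measurable_funM; exact: measurableT_comp.
- by move=> x; exact: L1Z.
- exact: L1M_independent.
under eq_Rintegral do rewrite RintegralZl//.
by rewrite RintegralZr.
Qed.

End independent_pair.

(** * Independence of one Gaussian coordinate from all the others *)

Lemma g_sigma_id_measurable disp (T : measurableType disp) (G : set (set T)) :
  G `<=` measurable -> measurable_fun setT (id : T -> g_sigma_algebraType G).
Proof.
move=> Gm _ A mA; rewrite setTI preimage_id.
by apply: smallest_sub mA => //; exact: sigma_algebra_measurable.
Qed.

Section others.
Context disp (Omega : measurableType disp) (R : realType)
  (P : probability Omega R) (d : nat) (u : nat -> Omega -> 'rV[R]_d).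
Hypothesis iid : iid_standard_gaussian P u.
Local Notation N := (@normal_prob R 0 1).

Lemma gaussian_coord_measurable s j :
  measurable_fun setT (fun w => u s w ord0 j).
Proof. by have [/(_ s)[]] := iid. Qed.

(** All times and coordinates are constrained at once; finite-dimensional cylinders are obtained by
    taking [B s j = setT] for large [s]. *)
Definition box (B : nat -> 'I_d -> set R) : set Omega :=
  [set w | forall s j, B s j (u s w ord0 j)].

Lemma box_bigcap n B : (forall s j, (n <= s)%N -> B s j = setT) ->
  box B = \bigcap_(s in [set` [fset s in iota 0 n]%fset])
    \bigcap_(j in [set` [fset j in 'I_d]%fset])
      (fun w => u s w ord0 j) @^-1` B s j.
Proof.
move=> Bn; apply/seteqP; split=> [w Bw s _ j _|w Bw s j]; first exact: Bw.
have [sn|ns] := ltnP s n; last by rewrite Bn.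
by apply: Bw; rewrite /= !inE// mem_iota.
Qed.

(** Independence is used twice: first between the vectors [u s], then between the coordinates of
    each of them. *)
Lemma probability_box n B : (forall s j, measurable (B s j)) ->
  (forall s j, (n <= s)%N -> B s j = setT) ->
  P (box B) = (\prod_(s < n) \prod_(j < d) N (B s j))%E.
Proof.
move=> mB Bn; rewrite (box_bigcap Bn).
have [G I] := iid.
rewrite (I _ (fun s => \bigcap_(j in [set` [fset j in 'I_d]%fset])
  (fun w => u s w ord0 j) @^-1` B s j)); last first.
  move=> s _; rewrite /sigma_rV /g_sigma_preimage.
  set H := \big[_/_]_(i < d) _.
  apply: (@fin_bigcap_measurable _ (g_sigma_algebraType H)) => //.
  move=> j _; apply: sub_sigma_algebra; rewrite /H (bigD1 j)//=; left.
  by exists (B s j) => //; rewrite setTI.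
rewrite (perm_big (index_iota 0 n)) /=; last first.
  apply: uniq_perm; rewrite ?fset_uniq ?iota_uniq// => s.
  by rewrite !inE /index_iota subn0.
rewrite big_mkord; apply: eq_bigr => s _.
have [_ Gl /(_ _ (fun j => (fun w => u s w ord0 j) @^-1` B s j)) ->] := G s.
  rewrite (perm_big (index_enum 'I_d)) /=; last first.
    apply: uniq_perm; rewrite ?fset_uniq ?index_enum_uniq// => j.
    by rewrite !inE mem_index_enum.
  by apply: eq_bigr => j _; rewrite Gl.
by move=> j _; exists (B s j) => //; rewrite setTI.
Qed.

Lemma measurable_box n B : (forall s j, measurable (B s j)) ->
  (forall s j, (n <= s)%N -> B s j = setT) -> measurable (box B).
Proof.
move=> mB Bn; rewrite (box_bigcap Bn).
apply: fin_bigcap_measurable => // s _; apply: fin_bigcap_measurable => // j _.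
by rewrite -[X in measurable X]setTI; exact: gaussian_coord_measurable.
Qed.

Variables (t : nat) (i : 'I_d).

(** Cylinders leaving the [i]-th coordinate of [u t] free. They are closed under intersection, as
    the uniqueness theorem for measures requires of a generating family. *)
Definition others_boxes : set (set Omega) :=
  [set A | exists B, [/\ forall s j, measurable (B s j),
    exists n, forall s j, (n <= s)%N -> B s j = setT,
    B t i = setT & A = box B]].

(* [Omega] with the sigma-algebra generated by all the coordinates
   of the [u s] except the [i]-th one of [u t]. *)
Definition others := g_sigma_algebraType others_boxes.

Lemma others_boxes_measurable : others_boxes `<=` measurable.
Proof. by move=> _ [B [mB [n Bn] _ ->]]; exact: measurable_box Bn. Qed.

Lemma others_id_measurable : measurable_fun setT (id : Omega -> others).
Proof. exact: g_sigma_id_measurable others_boxes_measurable. Qed.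

Lemma others_boxes_setI : setI_closed others_boxes.
Proof.
move=> _ _ [B [mB [n Bn] Bti ->]] [B' [mB' [n' Bn'] Bti' ->]].
exists (fun s j => B s j `&` B' s j); split.
- by move=> s j; exact: measurableI.
- exists (maxn n n') => s j; rewrite geq_max => /andP[ns ns'].
  by rewrite Bn// Bn'// setTI.
- by rewrite Bti Bti' setTI.
- apply/seteqP; split=> [w [Bw Bw'] s j|w Bw]; first by split.
  by split=> s j; have [] := Bw s j.
Qed.

Lemma others_coord_measurable s j : (s, j) != (t, i) ->
  measurable_fun setT (fun w : others => u s w ord0 j).
Proof.
move=> sj _ C mC; rewrite setTI; apply: sub_sigma_algebra.
exists (fun s' j' => if (s', j') == (s, j) then C else setT); split.
- by move=> s' j'; case: ifP.
- exists s.+1 => s' j' ss'; case: eqP => // -[s's _].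
  by rewrite s's ltnn in ss'.
- by rewrite eq_sym (negbTE sj).
- apply/seteqP; split=> [w Cw s' j'|w /(_ s j)]; last by rewrite eqxx.
  by case: eqP => // -[-> ->].
Qed.

(** Putting [C] into the free slot of the cylinder gives another cylinder, whose probability has one
    factor [N [set: R]] replaced by [N C]. *)
Lemma others_box_independent A C : others_boxes A -> measurable C ->
  (P (A `&` (fun w => u t w ord0 i) @^-1` C) = P A * N C)%E.
Proof.
move=> [B [mB [n0 Bn0] Bti ->]] mC.
(* The horizon must exceed [t] for the factor indexed by [(t, i)] to occur in both products. *)
pose n := maxn n0 t.+1.
have tn : (t < n)%N by rewrite leq_maxr.
have Bn s j : (n <= s)%N -> B s j = setT.
  by rewrite geq_max => /andP[? _]; exact: Bn0.
pose B' s j := if (s, j) == (t, i) then C else B s j.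
have -> : box B `&` (fun w => u t w ord0 i) @^-1` C = box B'.
  apply/seteqP; split=> [w [Bw Cw] s j|w Bw].
    by rewrite /B'; case: eqP => [[-> ->]|].
  split=> [s j|]; last by have := Bw t i; rewrite /B' eqxx.
  by have := Bw s j; rewrite /B'; case: eqP => // -[-> ->]; rewrite Bti.
rewrite (@probability_box n B)// (@probability_box n B'); last 2 first.
- by move=> s j; rewrite /B'; case: ifP.
- move=> s j ns; rewrite /B'; case: eqP => [[st _]|_]; last exact: Bn.
  by move: ns; rewrite st leqNgt tn.
rewrite !pair_big/= (bigD1 (Ordinal tn, i))//= [in RHS](bigD1 (Ordinal tn, i))//=.
rewrite Bti /B' eqxx [N setT]probability_setT mul1e muleC; congr (_ * _)%E.
apply: eq_bigr => -[s j]/= sj; case: eqP => // -[st ji].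
have es : s = Ordinal tn by exact: val_inj.
by move: sj; rewrite es ji eqxx.
Qed.

(** With [C] fixed, both sides are finite measures in [A] that agree on the cylinders, hence on the
    sigma-algebra they generate. *)
Lemma others_independent A C : measurable (A : set others) -> measurable C ->
  (P (id @^-1` A `&` (fun w => u t w ord0 i) @^-1` C) = P (id @^-1` A) * N C)%E.
Proof.
move=> mA mC; rewrite preimage_id.
have mC' : measurable ((fun w => u t w ord0 i) @^-1` C).
  by rewrite -[X in measurable X]setTI; exact: gaussian_coord_measurable.
have NC : 0 <= fine (N C) by rewrite fine_ge0.
have NCE : (NngNum NC)%:num%:E = N C by rewrite /= fineK// fin_num_measure.
have := @g_sigma_algebra_measure_unique _ _ _ others_boxes
  others_boxes_measurable (fun=> setT) _ _ (mrestr P mC')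
  (mscale (NngNum NC) P) others_boxes_setI _ _ A mA.
rewrite /mrestr/= /mscale/= NCE muleC; apply.
- move=> _; exists (fun _ _ => setT); split => //; first by exists 0%N.
  by apply/seteqP; split.
- by apply/seteqP; split=> // w _; exists 0%N.
- by move=> B GB; rewrite muleC; exact: others_box_independent.
- by move=> _; rewrite ltey_eq fin_num_measure//; exact: measurableI.
Qed.

End others.

Arguments gaussian_coord_measurable {disp Omega R P d u} iid s j.
Arguments others_id_measurable {disp Omega R P d u} iid t i.
Arguments others_independent {disp Omega R P d u} iid t i A C.

(** * Moments of a fresh Gaussian vector *)

Lemma lipschitz_continuous (R : realType) (g : R -> R) (K : R) :
  (forall y z, `|g y - g z| <= K * `|y - z|) -> continuous g.
Proof.
move=> gK y; apply/cvgrPdist_le => e e0; near=> z.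
apply: (le_trans (gK y z)).
have K1 : 0 < `|K| + 1 by rewrite ltr_wpDl.
apply: (@le_trans _ _ ((`|K| + 1) * `|y - z|)).
  by rewrite ler_wpM2r// (le_trans (ler_norm K))// lerDl.
rewrite mulrC -ler_pdivlMr//.
by near: z; apply: cvgr_dist_le => //; rewrite divr_gt0.
Unshelve. all: by end_near. Qed.

Section gaussian_expectations.
Context disp (Omega : measurableType disp) (R : realType)
  (P : probability Omega R) (d : nat) (u : nat -> Omega -> 'rV[R]_d).
Hypothesis iid : iid_standard_gaussian P u.
Local Notation N := (@normal_prob R 0 1).

(** Stated one coordinate at a time, because the coordinates of [u t] are integrated out separately,
    each with all the other ones frozen. *)
Definition indep_of t (X : Omega -> R) :=
  forall i, measurable_fun setT (X : others u t i -> R).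

Section coordinate.
Variables (t : nat) (i : 'I_d) (X : Omega -> R) (g : R -> R).
Hypotheses (mX : measurable_fun setT (X : others u t i -> R)) (iX : L1fun P X).
Hypothesis ig : L1fun N g.

Lemma L1M_coord : L1fun P (fun w => X w * g (u t w ord0 i)).
Proof.
exact: (@L1M_independent _ _ _ _ _ (others u t i) R P N _ _
  (others_id_measurable iid t i)
  (gaussian_coord_measurable iid t i) (others_independent iid t i) X g mX iX ig).
Qed.

Lemma integralM_coord : (\int[P]_w (X w * g (u t w ord0 i)) =
  (\int[P]_w X w) * \int[N]_z g z)%R.
Proof.
exact: (@integralM_independent _ _ _ _ _ (others u t i) R P N _ _
  (others_id_measurable iid t i)
  (gaussian_coord_measurable iid t i) (others_independent iid t i) X g mX iX ig).
Qed.

End coordinate.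

Lemma L1_normal_exp k : L1fun N (fun z => z ^+ k).
Proof.
apply: (@L1_le _ _ _ N _ (fun z => `|z| ^+ k)); last exact: L1_normal_powr.
  exact: measurable_funX.
by move=> z; rewrite normrX.
Qed.

Section norms.
Variables (t : nat) (X : Omega -> R).
Hypotheses (mX : indep_of t X) (iX : L1fun P X).

Lemma L1M_sum_pow k : L1fun P (fun w => X w * \sum_(i < d) u t w ord0 i ^+ k).
Proof.
under eq_fun do rewrite mulr_sumr.
apply: L1_sum => i.
exact: (@L1M_coord t i X (fun z => z ^+ k) (@mX i) iX (L1_normal_exp k)).
Qed.

Lemma integralM_sum_pow k :
  (\int[P]_w (X w * \sum_(i < d) u t w ord0 i ^+ k) =
   d%:R * (\int[N]_z (z ^+ k)) * \int[P]_w X w)%R.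
Proof.
under eq_Rintegral do rewrite mulr_sumr.
rewrite integral_sum_L1; last first.
  by move=> i;
    exact: (@L1M_coord t i X (fun z => z ^+ k) (@mX i) iX (L1_normal_exp k)).
under eq_bigr do rewrite (@integralM_coord t _ X (fun z => z ^+ k) (@mX _) iX
  (L1_normal_exp k)).
by rewrite sumr_const card_ord -[LHS]mulr_natl mulrA mulrAC.
Qed.

Lemma L1M_sqn : L1fun P (fun w => X w * sqn (u t w)).
Proof. by under eq_fun do rewrite sqnE; exact: L1M_sum_pow. Qed.

Lemma integralM_sqn : (\int[P]_w (X w * sqn (u t w)) = d%:R * \int[P]_w X w)%R.
Proof.
under eq_Rintegral do rewrite sqnE.
by rewrite integralM_sum_pow normal_moment2 mulr1.
Qed.

End norms.

(** Cauchy-Schwarz between the all-ones vector and the vector of squared coordinates. It reduces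
    moments of the norm to one-dimensional moments. *)
Lemma sqr_sqn_le (x : 'rV[R]_d) :
  sqn x ^+ 2 <= d%:R * \sum_(i < d) x ord0 i ^+ 4.
Proof.
have := dot_sqr_le (const_mx 1 : 'rV[R]_d) (\row_i (x ord0 i ^+ 2)).
have -> : dot (const_mx 1) (\row_i (x ord0 i ^+ 2)) = sqn x.
  by apply: eq_bigr => i _; rewrite !mxE mul1r expr2.
have -> : sqn (const_mx 1 : 'rV[R]_d) = d%:R.
  under [LHS]eq_bigr do rewrite !mxE mulr1.
  by rewrite sumr_const card_ord.
suff -> : sqn (\row_i (x ord0 i ^+ 2)) = \sum_(i < d) x ord0 i ^+ 4 by [].
by apply: eq_bigr => i _; rewrite !mxE -exprD.
Qed.

(* Cauchy-Schwarz applied to [x_i] and [x_i ^+ 3] bounds the fourth powers. *)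
Lemma cube_sqn_le (x : 'rV[R]_d) :
  sqn x ^+ 3 <= d%:R ^+ 2 * \sum_(i < d) x ord0 i ^+ 6.
Proof.
set q := sqn x; set s4 := \sum_(i < d) x ord0 i ^+ 4; set s6 := \sum_(i < d) _.
have h1 : q ^+ 2 <= d%:R * s4 by exact: sqr_sqn_le.
have h2 : s4 ^+ 2 <= q * s6.
  have := dot_sqr_le x (\row_i (x ord0 i ^+ 3)).
  have -> : dot x (\row_i (x ord0 i ^+ 3)) = s4.
    by apply: eq_bigr => i _; rewrite !mxE exprS.
  suff -> : sqn (\row_i (x ord0 i ^+ 3)) = s6 by [].
  by apply: eq_bigr => i _; rewrite !mxE -exprD.
have q0 : 0 <= q by exact: sqn_ge0.
have s40 : 0 <= s4 by apply: sumr_ge0 => i _; rewrite exprn_even_ge0.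
have s60 : 0 <= s6 by apply: sumr_ge0 => i _; rewrite exprn_even_ge0.
have [q_0|qn0] := eqVneq q 0.
  by rewrite q_0 expr0n mulr_ge0// sqr_ge0.
have qp : 0 < q by rewrite lt_neqAle eq_sym qn0.
(* After multiplication by [q], the chain is [q ^+ 4 <= (d%:R * s4) ^+ 2 <= d%:R ^+ 2 * (q *
   s6)]. *)
rewrite -(ler_pM2l qp) -exprS.
have -> : q ^+ 4 = (q ^+ 2) ^+ 2 by rewrite -exprM.
apply: (@le_trans _ _ ((d%:R * s4) ^+ 2)).
  by rewrite lerXn2r ?nnegrE ?sqr_ge0// mulr_ge0.
by rewrite exprMn [leRHS]mulrCA ler_wpM2l ?sqr_ge0.
Qed.

Section norms_power.
Variables (t : nat) (X : Omega -> R).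
Hypotheses (mX : indep_of t X) (iX : L1fun P X) (X0 : forall w, 0 <= X w).

Let mXsqn k : measurable_fun setT (fun w => X w * sqn (u t w) ^+ k).
Proof.
apply: measurable_funM; first exact: L1_measurable iX.
apply: measurable_funX; apply: measurable_dot => i;
  exact: (gaussian_coord_measurable iid t i).
Qed.

Lemma L1M_sqn2 : L1fun P (fun w => X w * sqn (u t w) ^+ 2).
Proof.
apply: L1_le (L1Z d%:R (L1M_sum_pow mX iX 4)) => // w.
rewrite ger0_norm; last by rewrite mulr_ge0// sqr_ge0.
by rewrite [leRHS]mulrCA ler_wpM2l//; exact: sqr_sqn_le.
Qed.

(** The factor [3] is the fourth normal moment. The exact factor would be [d (d + 2)], but only the
    order in [d] matters. *)
Lemma integralM_sqn2 : (\int[P]_w (X w * sqn (u t w) ^+ 2) <=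
  3 * d%:R ^+ 2 * \int[P]_w X w)%R.
Proof.
have i4 := L1M_sum_pow mX iX 4.
apply: (@le_trans _ _ (\int[P]_w (d%:R * (X w * \sum_(i < d) u t w ord0 i ^+ 4)))%R).
  apply: le_Rintegral => //; [exact: L1M_sqn2|exact: L1Z|move=> w _].
  by rewrite [leRHS]mulrCA ler_wpM2l//; exact: sqr_sqn_le.
rewrite RintegralZl// integralM_sum_pow// normal_moment4.
by rewrite le_eqVlt; apply/orP; left; apply/eqP; ring.
Qed.

Lemma L1M_sqn3 : L1fun P (fun w => X w * sqn (u t w) ^+ 3).
Proof.
apply: L1_le (L1Z (d%:R ^+ 2) (L1M_sum_pow mX iX 6)) => // w.
rewrite ger0_norm; last by rewrite mulr_ge0// exprn_ge0// sqn_ge0.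
by rewrite [leRHS]mulrCA ler_wpM2l//; exact: cube_sqn_le.
Qed.

Lemma integralM_sqn3 : (\int[P]_w (X w * sqn (u t w) ^+ 3) <=
  15 * d%:R ^+ 3 * \int[P]_w X w)%R.
Proof.
have i6 := L1M_sum_pow mX iX 6.
apply: (@le_trans _ _
    (\int[P]_w (d%:R ^+ 2 * (X w * \sum_(i < d) u t w ord0 i ^+ 6)))%R).
  apply: le_Rintegral => //; [exact: L1M_sqn3|exact: L1Z|move=> w _].
  by rewrite [leRHS]mulrCA ler_wpM2l//; exact: cube_sqn_le.
rewrite RintegralZl// integralM_sum_pow// normal_moment6.
by rewrite le_eqVlt; apply/orP; left; apply/eqP; ring.
Qed.

End norms_power.

End gaussian_expectations.

(** * Conditional Gaussian integration by parts *)

Section by_parts.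
Context disp (Omega : measurableType disp) (R : realType)
  (P : probability Omega R) (d : nat) (u : nat -> Omega -> 'rV[R]_d).
Hypothesis iid : iid_standard_gaussian P u.
Local Notation N := (@normal_prob R 0 1).
Variables (f : 'rV[R]_d -> R) (L0 L1f : R).
Hypothesis df : forall y, differentiable f y.
Hypothesis lipf : forall y z, `|f y - f z| <= L0 * norm2 (y - z).
Hypothesis lipdf : forall y z,
  norm2 (gradient f y - gradient f z) <= L1f * norm2 (y - z).
Variables (delta : R) (t : nat) (i : 'I_d).
Variables (X : Omega -> 'rV[R]_d) (H Y : Omega -> R) (KH : R).
Hypothesis mX : measurable_rV (X : others u t i -> 'rV[R]_d).
Hypothesis mH : measurable_fun setT (H : others u t i -> R).
Hypothesis mY : measurable_fun setT (Y : others u t i -> R).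
Hypothesis bH : forall w, `|H w| <= KH.
Hypothesis intH : L1fun P (fun w =>
  H w * (u t w ord0 i * (f (X w + delta *: u t w) - Y w))).

Let upd (v : 'rV[R]_d) z : 'rV[R]_d :=
  \row_j (if j == i then z else v ord0 j).

Let pt (x : others u t i * R) := X x.1 + delta *: upd (u t x.1) x.2.

Let mpt : measurable_rV pt.
Proof.
apply: measurable_rVD.
  by move=> j; exact: (measurableT_comp (@mX j) (@measurable_fst _ _ _ _)).
apply: measurable_rVZ => // j.
under eq_fun do rewrite mxE.
have [_|ji] := eqVneq j i; first exact: measurable_snd.
have mj : measurable_fun setT (fun w : others u t i => u t w ord0 j).
  by apply: others_coord_measurable; rewrite xpair_eqE eqxx.
exact: (measurableT_comp mj (@measurable_fst _ _ _ _)).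
Qed.

Let h (x : others u t i * R) : R := H x.1 * (x.2 * (f (pt x) - Y x.1)).

Let dh (x : others u t i * R) : R :=
  H x.1 * (delta * gradient f (pt x) ord0 i).

Let mh : measurable_fun setT h.
Proof.
apply: measurable_funM; first exact: (measurableT_comp mH (@measurable_fst _ _ _ _)).
apply: measurable_funM => //.
apply: measurable_funB; last exact: (measurableT_comp mY (@measurable_fst _ _ _ _)).
exact: measurable_lipschitz_comp lipf mpt.
Qed.

Let mdh : measurable_fun setT dh.
Proof.
apply: measurable_funM; first exact: (measurableT_comp mH (@measurable_fst _ _ _ _)).
apply: measurable_funM => //.
apply: (measurable_lipschitz_comp (F := fun y => gradient f y ord0 i)) mpt.
by move=> y z; exact: (gradient_coord_lip lipdf).
Qed.

Let pt_line w z :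
  pt (w, z) = pt (w, 0) + z *: (delta *: delta_mx ord0 i).
Proof.
rewrite /pt/= -addrA; congr (_ + _); apply/rowP => j; rewrite !mxE eqxx/=.
by case: (j == i); rewrite ?mulr0 ?add0r ?mulr1 ?addr0// mulrC.
Qed.

Let norm2_delta : norm2 (delta_mx ord0 i : 'rV[R]_d) = 1.
Proof.
rewrite norm2_sqrt /dot (bigD1 i)//= mxE !eqxx mulr1 big1 ?addr0 ?sqrtr1//.
by move=> j ji; rewrite mxE (negbTE ji) andbF mulr0.
Qed.

Let dist_pt w z z' : norm2 (pt (w, z) - pt (w, z')) = `|delta| * `|z - z'|.
Proof.
rewrite (pt_line w z) (pt_line w z') opprD addrACA subrr add0r -scalerBl.
by rewrite !norm2Z norm2_delta mulr1 mulrC.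
Qed.

Let phi w z := f (pt (w, z)) - Y w.

Let dphi w z := delta * gradient f (pt (w, z)) ord0 i.

Let phi_derive w (z : R) : is_derive z 1 (phi w) (dphi w z).
Proof.
have := is_derive_line df (pt (w, 0)) (delta *: delta_mx ord0 i) z.
have -> : (fun r => f (pt (w, 0) + r *: (delta *: delta_mx ord0 i))) =
    (fun r => f (pt (w, r))).
  by apply/funext => r; rewrite -pt_line.
rewrite -pt_line dotZr.
have -> : dot (gradient f (pt (w, z))) (delta_mx ord0 i) =
    gradient f (pt (w, z)) ord0 i.
  rewrite /dot (bigD1 i)//= [delta_mx _ _ _ _]mxE !eqxx mulr1 big1 ?addr0//.
  by move=> j ji; rewrite [delta_mx _ _ _ _]mxE (negbTE ji) andbF mulr0.
move=> D; apply: is_derive_eq; by rewrite subr0.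
Qed.

(** The growth constant may depend on [w], since Stein's identity is applied for each [w]
    separately; it covers both [phi w] and [dphi w]. *)
Let K w := `|phi w 0| + `|L0| * `|delta| + `|delta| * (L0 + L1f / 2).

Let bK : 0 <= L0 + L1f / 2.
Proof.
apply: (le_trans (normr_ge0 (gradient f 0 ord0 i))).
exact: (gradient_coord_bound df lipdf lipf).
Qed.

Let phi_growth w z : `|phi w z| <= K w * (1 + `|z| ^+ 1).
Proof.
have K0 : 0 <= `|delta| * (L0 + L1f / 2) by rewrite mulr_ge0.
have h1 : `|f (pt (w, z)) - f (pt (w, 0))| <= `|L0| * `|delta| * `|z|.
  apply: (le_trans (lipf _ _)); rewrite dist_pt subr0 mulrA.
  by rewrite ler_wpM2r// ler_wpM2r// ler_norm.
have -> : phi w z = phi w 0 + (f (pt (w, z)) - f (pt (w, 0))).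
  by rewrite /phi; ring.
apply: (le_trans (ler_normD _ _)).
have a0 : 0 <= `|phi w 0| by [].
have b0 : 0 <= `|L0| * `|delta| by rewrite mulr_ge0.
have z0 : 0 <= `|z| by [].
rewrite /K expr1 mulrDr mulr1.
have : 0 <= (`|phi w 0| + `|delta| * (L0 + L1f / 2)) * `|z|.
  by rewrite mulr_ge0// addr_ge0.
have : (`|phi w 0| + `|L0| * `|delta| + `|delta| * (L0 + L1f / 2)) * `|z| =
  (`|phi w 0| + `|delta| * (L0 + L1f / 2)) * `|z| + `|L0| * `|delta| * `|z|.
  by ring.
lra.
Qed.

Let dphi_bound w z : `|dphi w z| <= `|delta| * (L0 + L1f / 2).
Proof.
rewrite normrM ler_wpM2l//; exact: (gradient_coord_bound df lipdf lipf).
Qed.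

Let dphi_growth w z : `|dphi w z| <= K w * (1 + `|z| ^+ 1).
Proof.
apply: (le_trans (dphi_bound w z)); rewrite expr1 [leRHS]mulrDr mulr1 /K.
have a0 : 0 <= `|phi w 0| by [].
have b0 : 0 <= `|L0| * `|delta| by rewrite mulr_ge0.
have K0 : 0 <= `|delta| * (L0 + L1f / 2) by rewrite mulr_ge0.
have : 0 <= (`|phi w 0| + `|L0| * `|delta| + `|delta| * (L0 + L1f / 2)) * `|z|.
  by rewrite mulr_ge0// !addr_ge0.
lra.
Qed.

Let dphi_continuous w : continuous (dphi w).
Proof.
apply: (@lipschitz_continuous _ _ (`|delta| * (L1f * `|delta|))) => y z.
rewrite /dphi -mulrBr normrM -mulrA ler_wpM2l//.
apply: (le_trans (gradient_coord_lip lipdf _ _ _)).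
by rewrite dist_pt mulrA.
Qed.

Let phi_measurable w : measurable_fun setT (phi w).
Proof.
apply: continuous_measurable_fun => z; apply: differentiable_continuous.
by apply/derivable1_diffP; apply: ex_derive.
Qed.

Let stein_phi w : (\int[N]_z h (w, z) = \int[N]_z dh (w, z))%R.
Proof.
change (\int[N]_z (H w * (z * phi w z)) = \int[N]_z (H w * dphi w z))%R.
rewrite RintegralZl//; last first.
  exact: L1_normal_growthM (phi_measurable w) (phi_growth w).
rewrite RintegralZl//; last first.
  apply: L1_normal_growth (dphi_growth w).
  exact: continuous_measurable_fun (@dphi_continuous w).
congr (_ * _); exact: stein (phi_derive w) (@dphi_continuous w) (phi_growth w)
  (dphi_growth w).
Qed.

Let pt_coord w : pt (w, u t w ord0 i) = X w + delta *: u t w.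
Proof.
rewrite /pt/=; congr (_ + _ *: _); apply/rowP => j; rewrite mxE.
by case: eqP => [->|].
Qed.

Let hE : (fun w => h (w, u t w ord0 i)) =
  fun w => H w * (u t w ord0 i * (f (X w + delta *: u t w) - Y w)).
Proof. by apply/funext => w; rewrite /h pt_coord. Qed.

Let mpair : measurable_fun setT
  (fun w => (w, u t w ord0 i) : others u t i * R).
Proof.
apply/measurable_fun_pairP; split; first exact: (others_id_measurable iid t i).
exact: (gaussian_coord_measurable iid t i).
Qed.

(** Fubini isolates the [i]-th coordinate of [u t], Stein's identity is applied to it, and Fubini
    reassembles the expectation. As functions of that coordinate alone, [H] is a constant factor and
    [Y] a constant summand killed by differentiation. *)
Lemma gaussian_by_parts :
  (\int[P]_w (H w * (u t w ord0 i * (f (X w + delta *: u t w) - Y w))) =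
  \int[P]_w (H w * (delta * gradient f (X w + delta *: u t w) ord0 i)))%R.
Proof.
have fub g := @fubini_independent _ _ _ _ _ (others u t i) R P N _ _
  (others_id_measurable iid t i) (gaussian_coord_measurable iid t i)
  (others_independent iid t i) g.
transitivity (\int[P]_w h (w, u t w ord0 i))%R; first by rewrite hE.
rewrite (fub h mh) /=; last 2 first.
- move=> w; apply: (@L1Z _ _ _ N (H w) (fun z => z * phi w z)).
  exact: L1_normal_growthM (phi_measurable w) (phi_growth w).
- by rewrite hE.
transitivity (\int[P]_w dh (w, u t w ord0 i))%R; last first.
  by apply: eq_Rintegral => w _; rewrite /dh pt_coord.
rewrite (fub dh mdh) /=; last 2 first.
- move=> w; apply: (@L1Z _ _ _ N (H w) (dphi w)).
  apply: L1_normal_growth (dphi_growth w).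
  exact: continuous_measurable_fun (@dphi_continuous w).
- apply: (@L1_le _ _ _ P _ (cst (KH * (`|delta| * (L0 + L1f / 2))))).
  + exact: (measurableT_comp mdh mpair).
  + by move=> w; rewrite normrM ler_pM//; exact: dphi_bound.
  + exact: finite_measure_integrable_cst.
by apply: eq_Rintegral => w _; exact: stein_phi.
Qed.

End by_parts.

(** * The residual feedback iterates *)

Section iterates_measurable.
Context (R : realType) (d : nat) (f : 'rV[R]_d -> R) (L : R).
Hypothesis lipf : forall y z, `|f y - f z| <= L * norm2 (y - z).
Context disp (Omega : measurableType disp).
Variables (eta delta : R) (x0 : 'rV[R]_d) (u x : nat -> Omega -> 'rV[R]_d).
Hypothesis itx : residual_feedback_iterates f eta delta x0 u x.

Lemma measurable_query s : measurable_rV (u s) -> measurable_rV (x s) ->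
  measurable_fun setT (fun w => f (x s w + delta *: u s w)).
Proof.
move=> mu mx; apply: measurable_lipschitz_comp lipf _.
by apply: measurable_rVD => //; exact: measurable_rVZ.
Qed.

(** [x t] is built from the [u s] with [s < t]. The measurable structure on [Omega] is arbitrary, so
    that coarser sigma-algebras can be plugged in. *)
Lemma measurable_iterates t : (forall s, (s < t)%N -> measurable_rV (u s)) ->
  measurable_rV (x t).
Proof.
have [x0E xSE] := itx.
(* The induction carries all earlier iterates, because one step uses the queries at two consecutive
   times. *)
suff H : (forall s, (s < t)%N -> measurable_rV (u s)) ->
    forall s, (s <= t)%N -> measurable_rV (x s) by move=> /H; exact.
elim: t => [_ s|t IH mu s].
  by rewrite leqn0 => /eqP ->; rewrite (funext x0E); exact: measurable_rV_cst.
have {}IH s' : (s' <= t)%N -> measurable_rV (x s').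
  by apply: IH => r rt; apply: mu; exact: ltnW.
rewrite leq_eqVlt => /orP[/eqP ->|]; last exact: IH.
rewrite (funext (xSE t)); apply: measurable_rVD; first exact: IH.
move=> i; under eq_fun do rewrite mxE; apply: measurableT_comp => //.
move: i; apply: measurable_rVZ => //.
have mq s' : (s' <= t)%N ->
    measurable_fun setT (fun w => f (x s' w + delta *: u s' w)).
  by move=> st; apply: measurable_query; [exact: mu|exact: IH].
case: t {IH} mu mq => [|t] mu mq; apply: measurable_rVZ => //.
- by apply: measurable_funM => //; exact: mq.
- exact: mu.
- by apply: measurable_funM => //; apply: measurable_funB; exact: mq.
- exact: mu.
Qed.

End iterates_measurable.

Section iterates.
Context (R : realType) (d : nat) (f : 'rV[R]_d -> R) (L0 L1f : R).
Hypotheses (L0_gt0 : 0 < L0) (L1_gt0 : 0 < L1f).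
Hypothesis lipf : forall y z, `|f y - f z| <= L0 * norm2 (y - z).
Hypothesis df : forall y, differentiable f y.
Hypothesis lipdf : forall y z,
  norm2 (gradient f y - gradient f z) <= L1f * norm2 (y - z).
Context disp (Omega : measurableType disp) (P : probability Omega R).
Variables (eta delta : R) (x0 : 'rV[R]_d) (u x : nat -> Omega -> 'rV[R]_d).
Hypothesis iid : iid_standard_gaussian P u.
Hypothesis itx : residual_feedback_iterates f eta delta x0 u x.
Hypotheses (eta_ge0 : 0 <= eta) (delta_gt0 : 0 < delta).

Local Notation g := (residual_feedback f delta u x).
Local Notation c t w := (gradient f (x t w)).

(** * Measurability and boundedness along the trajectory *)

Let mu_ t : measurable_rV (u t).
Proof. by move=> i; exact: (gaussian_coord_measurable iid t i). Qed.

Lemma iterates_others s t i : (s <= t)%N ->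
  measurable_rV (x s : others u t i -> 'rV[R]_d).
Proof.
move=> st; apply: (measurable_iterates lipf (Omega := others u t i) itx).
move=> r rs j; apply: others_coord_measurable.
by rewrite xpair_eqE ltn_eqF// (leq_trans rs).
Qed.

Let mx t : measurable_rV (x t).
Proof. exact: (measurable_iterates lipf itx). Qed.

Lemma query_others s t i : (s < t)%N -> measurable_fun setT
  (fun w : others u t i => f (x s w + delta *: u s w)).
Proof.
move=> st; apply: (measurable_query lipf); last first.
  exact: (iterates_others (ltnW st)).
by move=> j; apply: others_coord_measurable; rewrite xpair_eqE ltn_eqF//.
Qed.

Lemma measurable_grad_comp d1 (T : measurableType d1) (U : T -> 'rV[R]_d) :
  measurable_rV U -> measurable_rV (fun w => gradient f (U w)).
Proof.
move=> mU i; apply: (measurable_lipschitz_comp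
  (F := fun y => gradient f y ord0 i) _ mU).
by move=> y z; exact: (gradient_coord_lip lipdf).
Qed.

Lemma sqn_grad_le y : sqn (gradient f y) <= d%:R * (L0 + L1f / 2) ^+ 2.
Proof.
rewrite sqnE (@le_trans _ _ (\sum_(i < d) (L0 + L1f / 2) ^+ 2))//.
  apply: ler_sum => i _; rewrite -real_normK ?num_real// lerXn2r ?nnegrE//.
    by rewrite addr_ge0 ?divr_ge0// ltW.
  exact: (gradient_coord_bound df lipdf lipf).
by rewrite sumr_const card_ord -[leLHS]mulr_natl.
Qed.

Lemma L1_sqn_grad d1 (T : measurableType d1) (Q : probability T R)
  (U : T -> 'rV[R]_d) : measurable_rV U ->
  L1fun Q (fun w => sqn (gradient f (U w))).
Proof.
move=> mU; have mG := measurable_grad_comp mU.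
apply: (@L1_le _ _ _ Q _ (cst (d%:R * (L0 + L1f / 2) ^+ 2))).
- exact: measurable_dot.
- by move=> w; rewrite ger0_norm ?sqn_ge0// sqn_grad_le.
- exact: finite_measure_integrable_cst.
Qed.

Lemma sqn_grad_indep s t : (s <= t)%N -> indep_of u t (fun w => sqn (c s w)).
Proof.
move=> st i; have mG := measurable_grad_comp (iterates_others (i := i) st).
exact: measurable_dot.
Qed.

Lemma indep_cst t k : indep_of u t (fun=> k).
Proof. by move=> i; exact: measurable_cst. Qed.

Lemma L1_cst k : L1fun P (fun=> k).
Proof. exact: finite_measure_integrable_cst. Qed.

Lemma integral_cst_prob k : (\int[P]_w k = k)%R.
have P1 : fine (P [set: Omega]) = 1 by rewrite probability_setT.
by rewrite Rintegral_cst// -[RHS]mulr1; congr (_ * _); exact: P1.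
Qed.

Lemma L1_sqn_u t : L1fun P (fun w => sqn (u t w)).
Proof.
have := L1M_sqn iid (@indep_cst t 1) (L1_cst 1).
by congr (P.-integrable _ _); apply/funext => w /=; rewrite mul1r.
Qed.

Lemma integral_sqn_u t : (\int[P]_w (sqn (u t w)) = d%:R)%R.
Proof.
have := integralM_sqn iid (@indep_cst t 1) (L1_cst 1).
rewrite integral_cst_prob mulr1 => <-.
by apply: eq_Rintegral => w _; rewrite mul1r.
Qed.

Lemma L1_sqn3_u t : L1fun P (fun w => sqn (u t w) ^+ 3).
Proof.
have := L1M_sqn3 iid (@indep_cst t 1) (L1_cst 1) (fun=> ler01).
by congr (P.-integrable _ _); apply/funext => w /=; rewrite mul1r.
Qed.

Lemma integral_sqn3_u t : (\int[P]_w (sqn (u t w) ^+ 3) <= 15 * d%:R ^+ 3)%R.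
Proof.
have := integralM_sqn3 iid (@indep_cst t 1) (L1_cst 1) (fun=> ler01).
rewrite integral_cst_prob mulr1; apply: le_trans.
rewrite le_eqVlt; apply/orP; left; apply/eqP.
by apply: eq_Rintegral => w _; rewrite mul1r.
Qed.

(* The query points [x t.+1 + delta u_t.+1] and [x t + delta u_t] are compared
   through [x t + delta u_t.+1]: the first gap is controlled by [L0] and the
   last step, the second one by a Taylor expansion at [x t]. *)
Lemma sqn_feedbackS_le t w :
  sqn (g t.+1 w) <=
    2 * L0 ^+ 2 * eta ^+ 2 / delta ^+ 2 * (sqn (g t w) * sqn (u t.+1 w)) +
    (8 * (sqn (c t w) * sqn (u t.+1 w) ^+ 2 +
          sqn (c t w) * sqn (u t w) * sqn (u t.+1 w)) +
     L1f ^+ 2 * delta ^+ 2 * (4 * sqn (u t.+1 w) ^+ 3 + 2 * sqn (u t w) ^+ 3)).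
Proof.
have [_ xSE] := itx.
set p := sqn (u t.+1 w); set q := sqn (u t w).
have p0 : 0 <= p by exact: sqn_ge0.
have q0 : 0 <= q by exact: sqn_ge0.
set C := sqn (c t w); have C0 : 0 <= C by exact: sqn_ge0.
set G := sqn (g t w); have G0 : 0 <= G by exact: sqn_ge0.
pose D1 := f (x t.+1 w + delta *: u t.+1 w) - f (x t w + delta *: u t.+1 w).
pose D2 := f (x t w + delta *: u t.+1 w) - f (x t w + delta *: u t w).
have -> : sqn (g t.+1 w) = (D1 + D2) ^+ 2 * p / delta ^+ 2.
  by rewrite /= !dotE -/p /D1 /D2; field; rewrite gt_eqF.
have h1 : D1 ^+ 2 <= L0 ^+ 2 * (eta ^+ 2 * G).
  rewrite -[D1 ^+ 2]real_normK ?num_real//.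
  have -> : L0 ^+ 2 * (eta ^+ 2 * G) = (L0 * norm2 (eta *: g t w)) ^+ 2.
    by rewrite norm2Z !exprMn sqr_norm2 real_normK// num_real.
  rewrite lerXn2r ?nnegrE ?mulr_ge0 ?norm2_ge0 ?(ltW L0_gt0)//.
  apply: (le_trans (lipf _ _)); rewrite xSE.
  have -> : x t w - eta *: g t w + delta *: u t.+1 w -
     (x t w + delta *: u t.+1 w) = - (eta *: g t w).
    by rewrite opprD addrACA subrr addr0 addrAC subrr add0r.
  by rewrite norm2N.
pose e := dot (c t w) (u t.+1 w - u t w).
pose r := D2 - delta * e.
have he : e ^+ 2 <= 2 * (C * (p + q)).
  apply: (le_trans (dot_sqr_le _ _)); rewrite -/C mulrCA ler_wpM2l//.
  have := sqn_ge0 (u t.+1 w + u t w).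
  rewrite !dotE -/p -/q (dotC (u t w)); lra.
have hr : `|r| <= L1f / 2 * delta ^+ 2 * (p + q).
  have t1 := taylor_bound df lipdf (x t w) (delta *: u t.+1 w).
  have t2 := taylor_bound df lipdf (x t w) (delta *: u t w).
  have -> : r = (f (x t w + delta *: u t.+1 w) - f (x t w) -
       dot (c t w) (delta *: u t.+1 w)) -
     (f (x t w + delta *: u t w) - f (x t w) - dot (c t w) (delta *: u t w)).
    by rewrite /r /D2 /e !dotE; ring.
  apply: (le_trans (ler_normB _ _)); apply: (le_trans (lerD t1 t2)).
  by rewrite !dotE -/p -/q le_eqVlt; apply/orP; left; apply/eqP; ring.
have hr2 : r ^+ 2 <= (L1f / 2 * delta ^+ 2 * (p + q)) ^+ 2.
  rewrite -[r ^+ 2]real_normK ?num_real// lerXn2r ?nnegrE//.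
  by rewrite (le_trans _ hr).
have h2 : D2 ^+ 2 <= 2 * (delta ^+ 2 * (2 * (C * (p + q)))) +
    2 * (L1f / 2 * delta ^+ 2 * (p + q)) ^+ 2.
  have -> : D2 = delta * e + r by rewrite /r; ring.
  have d2e : delta ^+ 2 * e ^+ 2 <= delta ^+ 2 * (2 * (C * (p + q))).
    by rewrite ler_wpM2l// sqr_ge0.
  have -> : (delta * e + r) ^+ 2 =
      2 * (delta ^+ 2 * e ^+ 2) + 2 * r ^+ 2 - (delta * e - r) ^+ 2 by ring.
  have s0 := sqr_ge0 (delta * e - r).
  by apply: le_trans (lerD (ler_wpM2l _ d2e) (ler_wpM2l _ hr2)) => //;
    rewrite gerDl oppr_le0.
have h12 : (D1 + D2) ^+ 2 <= 2 * D1 ^+ 2 + 2 * D2 ^+ 2.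
  have -> : (D1 + D2) ^+ 2 = 2 * D1 ^+ 2 + 2 * D2 ^+ 2 - (D1 - D2) ^+ 2 by ring.
  by rewrite gerDl oppr_le0 sqr_ge0.
(* The mixed products coming from the squared remainder are traded for pure cubes, whose
   expectations are sixth moments of the norm. *)
have hpq : (p + q) ^+ 2 * p <= 4 * p ^+ 3 + 2 * q ^+ 3.
  have : 0 <= (p + q) * (p - q) ^+ 2 by rewrite mulr_ge0 ?sqr_ge0// addr_ge0.
  have : 0 <= p ^+ 3 by rewrite exprn_ge0.
  have : 0 <= q ^+ 3 by rewrite exprn_ge0.
  have : 0 <= p * (p - q) ^+ 2 by rewrite mulr_ge0 ?sqr_ge0.
  have : 0 <= q * (p - q) ^+ 2 by rewrite mulr_ge0 ?sqr_ge0.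
  rewrite !exprS !expr0 !mulr1; nra.
have dd : 0 < delta ^+ 2 by rewrite exprn_gt0.
apply: (@le_trans _ _ ((2 * (L0 ^+ 2 * (eta ^+ 2 * G)) +
   2 * (2 * (delta ^+ 2 * (2 * (C * (p + q)))) +
    2 * (L1f / 2 * delta ^+ 2 * (p + q)) ^+ 2)) * p / delta ^+ 2)).
  rewrite ler_wpM2r ?invr_ge0 ?(ltW dd)// ler_wpM2r//.
  by apply: (le_trans h12); apply: lerD; rewrite ler_wpM2l.
have -> : (2 * (L0 ^+ 2 * (eta ^+ 2 * G)) +
   2 * (2 * (delta ^+ 2 * (2 * (C * (p + q)))) +
    2 * (L1f / 2 * delta ^+ 2 * (p + q)) ^+ 2)) * p / delta ^+ 2 =
   2 * L0 ^+ 2 * eta ^+ 2 / delta ^+ 2 * (G * p) +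
    (8 * (C * p ^+ 2 + C * q * p) + L1f ^+ 2 * delta ^+ 2 * ((p + q) ^+ 2 * p)).
  by field; rewrite gt_eqF.
by rewrite !lerD2l ler_wpM2l// mulr_ge0 ?sqr_ge0.
Qed.

(** The default [0] at time zero merges the two cases of the feedback into a single formula. *)
Let yprev t w :=
  if t is s.+1 then f (x s w + delta *: u s w) else 0.

Let feedbackE t w :
  g t w = ((f (x t w + delta *: u t w) - yprev t w) / delta) *: u t w.
Proof. by case: t => [|t] //=; rewrite subr0. Qed.

Lemma feedback_others s t i : (s < t)%N ->
  measurable_rV (g s : others u t i -> 'rV[R]_d).
Proof.
move=> st; rewrite (funext (feedbackE s)); apply: measurable_rVZ.
  apply: measurable_funM => //; apply: measurable_funB; first exact: query_others.
  case: s st => [|s] st /=; first exact: measurable_cst.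
  by apply: query_others; exact: ltnW.
by move=> j; apply: others_coord_measurable; rewrite xpair_eqE ltn_eqF.
Qed.

Lemma measurable_feedback t : measurable_rV (g t).
Proof.
rewrite (funext (feedbackE t)); apply: measurable_rVZ => //.
apply: measurable_funM => //; apply: measurable_funB.
  exact: (measurable_query lipf).
case: t => [|t]; first exact: measurable_cst.
exact: (measurable_query lipf delta (@mu_ t) (@mx t)).
Qed.

Lemma sqn_feedback_indep s t : (s < t)%N -> indep_of u t (fun w => sqn (g s w)).
Proof.
move=> st i; have m := feedback_others (i := i) st.
exact: measurable_dot.
Qed.

(** The base case of square integrability. The factor [1] is the constant weight [X] of
    [L1M_sqn2]. *)
Lemma sqn_feedback0_le w : sqn (g 0%N w) <=
  2 * f x0 ^+ 2 / delta ^+ 2 * sqn (u 0%N w) +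
  2 * L0 ^+ 2 * (1 * sqn (u 0%N w) ^+ 2).
Proof.
have [x0E _] := itx.
set p := sqn (u 0%N w); have p0 : 0 <= p by exact: sqn_ge0.
pose D := f (x0 + delta *: u 0%N w) - f x0.
have -> : sqn (g 0%N w) = (f x0 + D) ^+ 2 * p / delta ^+ 2.
  by rewrite /= !dotE x0E -/p /D; field; rewrite gt_eqF.
have h1 : D ^+ 2 <= L0 ^+ 2 * (delta ^+ 2 * p).
  rewrite -[D ^+ 2]real_normK ?num_real//.
  have -> : L0 ^+ 2 * (delta ^+ 2 * p) = (L0 * norm2 (delta *: u 0%N w)) ^+ 2.
    by rewrite norm2Z !exprMn sqr_norm2 real_normK// num_real.
  rewrite lerXn2r ?nnegrE ?mulr_ge0 ?norm2_ge0 ?(ltW L0_gt0)//.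
  by apply: (le_trans (lipf _ _)); rewrite addrAC subrr add0r.
have dd : 0 < delta ^+ 2 by rewrite exprn_gt0.
have -> : 2 * f x0 ^+ 2 / delta ^+ 2 * p + 2 * L0 ^+ 2 * (1 * p ^+ 2) =
  (2 * f x0 ^+ 2 + 2 * (L0 ^+ 2 * (delta ^+ 2 * p))) * p / delta ^+ 2.
  by field; rewrite gt_eqF.
rewrite ler_wpM2r ?invr_ge0 ?(ltW dd)// ler_wpM2r//.
apply: (@le_trans _ _ (2 * f x0 ^+ 2 + 2 * D ^+ 2)); last first.
  by rewrite lerD2l ler_wpM2l.
have -> : (f x0 + D) ^+ 2 = 2 * f x0 ^+ 2 + 2 * D ^+ 2 - (f x0 - D) ^+ 2 by ring.
by rewrite gerDl oppr_le0 sqr_ge0.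
Qed.

Let L1_noise t : L1fun P (fun w =>
  L1f ^+ 2 * delta ^+ 2 * (4 * sqn (u t.+1 w) ^+ 3 + 2 * sqn (u t w) ^+ 3)).
Proof. by apply: L1Z; apply: L1D; apply: L1Z; exact: L1_sqn3_u. Qed.

Let L1_grad_u t : L1fun P (fun w => sqn (c t w) * sqn (u t w)).
Proof. exact: (L1M_sqn iid (sqn_grad_indep (leqnn t)) (L1_sqn_grad P (@mx t))). Qed.

Let grad_u_indep t : indep_of u t.+1 (fun w => sqn (c t w) * sqn (u t w)).
Proof.
move=> i; apply: measurable_funM; first exact: (sqn_grad_indep (leqnSn t)).
have m : measurable_rV (u t : others u t.+1 i -> _).
  by move=> j; apply: others_coord_measurable; rewrite xpair_eqE ltn_eqF.
exact: measurable_dot.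
Qed.

Let L1_grad_uu t : L1fun P (fun w => sqn (c t w) * sqn (u t w) * sqn (u t.+1 w)).
Proof. exact: (L1M_sqn iid (@grad_u_indep t) (L1_grad_u t)). Qed.

Let L1_grad_u2 t : L1fun P (fun w => sqn (c t w) * sqn (u t.+1 w) ^+ 2).
Proof.
apply: (L1M_sqn2 iid (sqn_grad_indep (leqnSn t)) (L1_sqn_grad P (@mx t))).
by move=> w; exact: sqn_ge0.
Qed.

Lemma L1_sqn_feedback t : L1fun P (fun w => sqn (g t w)).
Proof.
have mg s : measurable_fun setT (fun w => sqn (g s w)).
  by have m := measurable_feedback s; exact: measurable_dot.
elim: t => [|t IH].
  apply: (L1_le (mg 0%N)) => [w|].
    by rewrite ger0_norm ?sqn_ge0//; exact: sqn_feedback0_le.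
  apply: L1D; apply: L1Z; first exact: L1_sqn_u.
  exact: (L1M_sqn2 iid (@indep_cst 0 1) (L1_cst 1) (fun=> ler01)).
apply: (L1_le (mg t.+1)) => [w|].
  by rewrite ger0_norm ?sqn_ge0//; exact: sqn_feedbackS_le.
apply: L1D.
  by apply: L1Z; exact: (L1M_sqn iid (sqn_feedback_indep (ltnSn t)) IH).
apply: L1D; last exact: L1_noise.
by apply: L1Z; apply: L1D; [exact: L1_grad_u2|exact: L1_grad_uu].
Qed.

(** The expectation of [sqn_feedbackS_le], integrating out [u t.+1] before [u t]. The constant [32]
    is [8 * (3 + 1)], from a fourth moment of [u t.+1] and from the product of two second moments;
    [90] is [(4 + 2) * 15], from the sixth moments. *)
Lemma integral_sqn_feedbackS_le t :
  (\int[P]_w sqn (g t.+1 w) <=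
    2 * L0 ^+ 2 * eta ^+ 2 / delta ^+ 2 * d%:R * \int[P]_w sqn (g t w) +
    32 * d%:R ^+ 2 * \int[P]_w sqn (c t w) +
    90 * L1f ^+ 2 * delta ^+ 2 * d%:R ^+ 3)%R.
Proof.
have L1gu := L1M_sqn iid (sqn_feedback_indep (ltnSn t)) (L1_sqn_feedback t).
have L1c := L1_sqn_grad P (@mx t).
have L1cuu := L1D (L1_grad_u2 t) (L1_grad_uu t).
have H := le_Rintegral measurableT (L1_sqn_feedback t.+1)
  (L1D (L1Z (2 * L0 ^+ 2 * eta ^+ 2 / delta ^+ 2) L1gu)
    (L1D (L1Z 8 L1cuu) (L1_noise t)))
  (fun w _ => sqn_feedbackS_le t w).
apply: (le_trans H) => {H}.
rewrite RintegralD//; [|exact: L1Z|by apply: L1D; [exact: L1Z|exact: L1_noise]].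
rewrite RintegralZl// (integralM_sqn iid (sqn_feedback_indep (ltnSn t))
  (L1_sqn_feedback t)).
rewrite RintegralD//; last exact: L1Z.
rewrite RintegralZl// RintegralD//.
rewrite (integralM_sqn iid (@grad_u_indep t) (L1_grad_u t)).
rewrite (integralM_sqn iid (sqn_grad_indep (leqnn t)) L1c).
have h2 := integralM_sqn2 iid (sqn_grad_indep (leqnSn t)) L1c
  (fun w => sqn_ge0 (c t w)).
rewrite RintegralZl//; last by apply: L1D; apply: L1Z; exact: L1_sqn3_u.
rewrite RintegralD//; [|by apply: L1Z; exact: L1_sqn3_u..].
rewrite !RintegralZl//; [|exact: L1_sqn3_u..].
rewrite -addrA; apply: lerD; first by rewrite mulrA.
apply: lerD.
  rewrite -mulrA; have -> : (32 : R) = 8 * 4 by rewrite -natrM.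
  rewrite -mulrA ler_wpM2l//.
  rewrite (_ : 4 * (d%:R ^+ 2 * \int[P]_w sqn (c t w)) =
    3 * d%:R ^+ 2 * (\int[P]_w sqn (c t w)) +
      d%:R * (d%:R * \int[P]_w sqn (c t w)))%R; last by ring.
  by rewrite lerD2r.
rewrite (_ : 90 * L1f ^+ 2 * delta ^+ 2 * d%:R ^+ 3 =
  L1f ^+ 2 * delta ^+ 2 * (4 * (15 * d%:R ^+ 3) + 2 * (15 * d%:R ^+ 3)));
  last by ring.
have K0 : 0 <= L1f ^+ 2 * delta ^+ 2 by rewrite mulr_ge0 ?sqr_ge0.
apply: (ler_wpM2l K0).
by apply: lerD; rewrite ler_wpM2l//; exact: integral_sqn3_u.
Qed.

Lemma norm2_le1D (y : 'rV[R]_d) : norm2 y <= 1 + sqn y.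
Proof.
rewrite -sqr_norm2; have := sqr_ge0 (norm2 y - 1); have := sqr_ge0 (norm2 y).
rewrite sqrrB1; lra.
Qed.

Lemma gradient_query_dot_ge y (v v' : 'rV[R]_d) :
  3 / 4 * sqn (gradient f y) -
    5 / 2 * (L1f ^+ 2 * delta ^+ 2) * (sqn v + sqn v') <=
  dot (gradient f (y + delta *: v)) (gradient f (y + delta *: v')).
Proof.
set C := gradient f y.
have shift_le z : sqn (gradient f (y + delta *: z) - C) <=
    L1f ^+ 2 * delta ^+ 2 * sqn z.
  rewrite -!sqr_norm2 -exprMn.
  have -> : (L1f * delta) ^+ 2 * norm2 z ^+ 2 = (L1f * norm2 (delta *: z)) ^+ 2.
    by rewrite norm2Z (gtr0_norm delta_gt0); ring.
  rewrite lerXn2r ?nnegrE ?norm2_ge0 ?mulr_ge0 ?norm2_ge0 ?(ltW L1_gt0)//.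
  by apply: (le_trans (lipdf _ _)); rewrite addrAC subrr add0r.
have := dot_perturb_ge C (gradient f (y + delta *: v) - C)
  (gradient f (y + delta *: v') - C).
have CK z : C + (z - C) = z by rewrite addrCA subrr addr0.
rewrite !CK; apply: le_trans.
by rewrite lerD2l lerN2 -[leRHS]mulrA ler_wpM2l// mulrDr lerD.
Qed.

Lemma norm2_coordM_le (a b : 'rV[R]_d) i :
  `|a ord0 i| <= L0 + L1f / 2 ->
  `|a ord0 i * b ord0 i| <= (L0 + L1f / 2) * (1 + sqn b).
Proof.
move=> ai; rewrite normrM ler_pM//.
exact: le_trans (ge_coord_norm2 _ _) (norm2_le1D _).
Qed.

(** * The linear term of the descent inequality *)

Section cross.
Variables (T t : nat).
Hypothesis tT : (t < T)%N.

Let a w := gradient f (x t w + delta *: u T w).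
Let b w := gradient f (x t w + delta *: u t w).

Let ma : measurable_rV a.
Proof.
apply: measurable_grad_comp; apply: measurable_rVD; first exact: (@mx t).
by apply: measurable_rVZ => //; exact: (@mu_ T).
Qed.

Let ai_le i w : `|a w ord0 i| <= L0 + L1f / 2.
Proof. exact: (gradient_coord_bound df lipdf lipf). Qed.

Let L1_cross_coord i : L1fun P (fun w => a w ord0 i * g t w ord0 i).
Proof.
have mg := @measurable_feedback t i; have ma' := @ma i.
apply: (@L1_le _ _ _ P _ (fun w => (L0 + L1f / 2) * (1 + sqn (g t w)))).
- exact: measurable_funM.
- by move=> w; exact: norm2_coordM_le.
- by apply: L1Z; apply: L1D; [exact: L1_cst|exact: L1_sqn_feedback].
Qed.

Lemma L1_cross : L1fun P (fun w => dot (a w) (g t w)).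
Proof. exact: L1_sum. Qed.

Let L1_ab_coord i : L1fun P (fun w => a w ord0 i * b w ord0 i).
Proof.
have mb : measurable_rV b.
  apply: measurable_grad_comp; apply: measurable_rVD; first exact: (@mx t).
  by apply: measurable_rVZ => //; exact: (@mu_ t).
have mb' := @mb i; have ma' := @ma i.
apply: (@L1_le _ _ _ P _ (cst ((L0 + L1f / 2) * (L0 + L1f / 2)))).
- exact: measurable_funM.
- move=> w; rewrite normrM ler_pM//.
  exact: (gradient_coord_bound df lipdf lipf).
- exact: L1_cst.
Qed.

(** Integration by parts with the [i]-th coordinate of [a] as [H], which involves [u T] but not
    [u t] because [t < T], and with the previous query value as [Y]. Both sides carry a factor
    [delta], which cancels. *)
Let cross_coordE i : (\int[P]_w (a w ord0 i * g t w ord0 i) =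
  \int[P]_w (a w ord0 i * b w ord0 i))%R.
Proof.
have dn : delta != 0 by rewrite gt_eqF.
have E w : a w ord0 i * (u t w ord0 i *
    (f (x t w + delta *: u t w) - yprev t w)) =
    delta * (a w ord0 i * g t w ord0 i).
  by rewrite feedbackE [(_ *: u t w) ord0 i]mxE; field.
have mX := iterates_others (i := i) (leqnn t).
have mH : measurable_fun setT (fun w : others u t i => a w ord0 i).
  apply: measurable_grad_comp; apply: measurable_rVD; first exact: mX.
  apply: measurable_rVZ => // j; apply: others_coord_measurable.
  by rewrite xpair_eqE gtn_eqF.
have mY : measurable_fun setT (fun w : others u t i => yprev t w).
  by case: (t) => [|s]; [exact: measurable_cst|exact: query_others].
have := gaussian_by_parts iid df lipf lipdf (delta := delta) mX mH mY (ai_le i).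
have -> : (fun w => a w ord0 i * (u t w ord0 i *
    (f (x t w + delta *: u t w) - yprev t w))) =
    (fun w => delta * (a w ord0 i * g t w ord0 i)) by exact: funext E.
move=> /(_ (L1Z delta (L1_cross_coord i))).
have -> : (fun w => a w ord0 i * (delta *
    gradient f (x t w + delta *: u t w) ord0 i)) =
    (fun w => delta * (a w ord0 i * b w ord0 i)).
  by apply/funext => w; rewrite mulrCA.
by rewrite !RintegralZl// => /(mulfI dn).
Qed.

Lemma integral_cross_ge :
  (3 / 4 * (\int[P]_w sqn (c t w)) - 5 * L1f ^+ 2 * delta ^+ 2 * d%:R <=
  \int[P]_w dot (a w) (g t w))%R.
Proof.
rewrite (integral_sum_L1 L1_cross_coord) (eq_bigr _ (fun i _ => cross_coordE i)).
rewrite -(integral_sum_L1 L1_ab_coord).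
have L1c := L1_sqn_grad P (@mx t).
have L1uu := L1D (L1_sqn_u T) (L1_sqn_u t).
have H := le_Rintegral measurableT (L1B (L1Z (3 / 4) L1c)
   (L1Z (5 / 2 * (L1f ^+ 2 * delta ^+ 2)) L1uu)) (L1_sum L1_ab_coord)
  (fun w _ => gradient_query_dot_ge (x t w) (u T w) (u t w)).
apply: le_trans H.
rewrite RintegralB//; [|exact: L1Z|exact: L1Z].
rewrite !RintegralZl// RintegralD//; [|exact: L1_sqn_u|exact: L1_sqn_u].
(* Each of the two Gaussian vectors contributes [d], turning [5 / 2] into [5]. *)
by rewrite !integral_sqn_u lerD2l lerN2 le_eqVlt; apply/orP; left; apply/eqP; field.
Qed.

Lemma descent_step w : f (x t.+1 w + delta *: u T w) <=
  f (x t w + delta *: u T w) - eta * dot (a w) (g t w) +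
    L1f * eta ^+ 2 / 2 * sqn (g t w).
Proof.
have [_ xSE] := itx.
have := taylor_bound df lipdf (x t w + delta *: u T w) (- (eta *: g t w)).
have -> : x t w + delta *: u T w - eta *: g t w = x t.+1 w + delta *: u T w.
  by rewrite xSE addrAC.
have -> : sqn (- (eta *: g t w)) = eta ^+ 2 * sqn (g t w).
  by rewrite -!sqr_norm2 norm2N norm2Z exprMn real_normK ?num_real.
have -> : dot (gradient f (x t w + delta *: u T w)) (- (eta *: g t w)) =
    - (eta * dot (a w) (g t w)) by rewrite dotNr dotZr.
rewrite ler_norml => /andP[_].
have -> : L1f / 2 * (eta ^+ 2 * sqn (g t w)) =
  L1f * eta ^+ 2 / 2 * sqn (g t w) by rewrite mulrA [L1f / 2 * _]mulrAC.
set A := sqn _; set B := dot _ _; lra.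
Qed.

End cross.

Lemma L1_query_le (y : Omega -> 'rV[R]_d) s : measurable_rV y ->
  L1fun P (fun w => f (y w)) -> L1fun P (fun w => f (y w + delta *: u s w)).
Proof.
move=> my iy.
apply: (@L1_le _ _ _ P _
    (fun w => `|f (y w)| + L0 * delta * (1 + sqn (u s w)))).
- apply: (measurable_lipschitz_comp lipf); apply: measurable_rVD => //.
  by apply: measurable_rVZ => //; exact: (@mu_ s).
- move=> w; rewrite -[f (y w + _)](subrK (f (y w))) addrC.
  apply: (le_trans (ler_normD _ _)); rewrite lerD2l.
  apply: (le_trans (lipf _ _)); rewrite addrAC subrr add0r norm2Z.
  rewrite (gtr0_norm delta_gt0) -mulrA !ler_wpM2l ?norm2_le1D//; exact: ltW.
- apply: L1D; first exact: L1_norm.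
  by apply: L1Z; apply: L1D; [exact: L1_cst|exact: L1_sqn_u].
Qed.

Lemma L1_iterates t : L1fun P (fun w => f (x t w)).
Proof.
have [x0E xSE] := itx.
elim: t => [|t IH].
  by under eq_fun do rewrite x0E; exact: L1_cst.
apply: (@L1_le _ _ _ P _
    (fun w => `|f (x t w)| + L0 * eta * (1 + sqn (g t w)))).
- exact: (measurable_lipschitz_comp lipf (@mx t.+1)).
- move=> w; rewrite -[f (x t.+1 w)](subrK (f (x t w))) addrC.
  apply: (le_trans (ler_normD _ _)); rewrite lerD2l.
  apply: (le_trans (lipf _ _)); rewrite xSE addrAC subrr add0r norm2N norm2Z.
  rewrite (ger0_norm eta_ge0) -mulrA !ler_wpM2l ?norm2_le1D//; exact: ltW.
- apply: L1D; first exact: L1_norm.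
  by apply: L1Z; apply: L1D; [exact: L1_cst|exact: L1_sqn_feedback].
Qed.

(** The same vector [u T] smooths [f] at every step, so that the descent inequalities telescope;
    [n <= T] keeps it independent of all the noise used so far. *)
Lemma descent_sum T n : (n <= T)%N ->
  (\int[P]_w f (x n w + delta *: u T w) +
    eta * \sum_(t < n) (3 / 4 * (\int[P]_w sqn (c t w)) -
      5 * L1f ^+ 2 * delta ^+ 2 * d%:R) <=
  \int[P]_w f (x0 + delta *: u T w) +
    L1f * eta ^+ 2 / 2 * \sum_(t < n) \int[P]_w sqn (g t w))%R.
Proof.
have [x0E _] := itx.
elim: n => [_|n IH nT].
  rewrite !big_ord0 !mulr0 !addr0 le_eqVlt; apply/orP; left; apply/eqP.
  by apply: eq_Rintegral => w _; rewrite x0E.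
rewrite !big_ord_recr/=.
have L1q s : L1fun P (fun w => f (x s w + delta *: u T w)).
  exact: (L1_query_le T (@mx s) (L1_iterates s)).
have L1c := L1_cross T n.
have L1g := L1_sqn_feedback n.
have L1qc := L1B (L1q n) (L1Z eta L1c).
have := le_Rintegral measurableT (L1q n.+1)
  (L1D L1qc (L1Z (L1f * eta ^+ 2 / 2) L1g)) (fun w _ => descent_step T n w).
rewrite RintegralD//; last exact: L1Z.
rewrite RintegralB//; last exact: L1Z.
rewrite !RintegralZl//.
have := IH (ltnW nT).
have := ler_wpM2l eta_ge0 (integral_cross_ge nT).
rewrite !mulrDr; lra.
Qed.

(** The displacement [delta * norm2 (u s w)] is at most half of its square plus one, and the
    expectation of its square is [delta ^+ 2 * d%:R]. *)
Lemma smoothing_gap s y : delta ^+ 2 * d%:R <= 1 ->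
  (`|\int[P]_w f (y + delta *: u s w) - f y| <= L0)%R.
Proof.
move=> dd1.
have L1f' : L1fun P (fun w => f (y + delta *: u s w)).
  exact: (L1_query_le s (@measurable_rV_cst _ _ _ _ y) (L1_cst (f y))).
have L1b := L1Z (L0 / 2) (L1D (L1Z (delta ^+ 2) (L1_sqn_u s)) (L1_cst 1)).
rewrite -[X in _ - X](integral_cst_prob (f y)) -RintegralB//; last exact: L1_cst.
have L1d := L1B L1f' (L1_cst (f y)).
apply: (le_trans (le_normr_Rintegral measurableT L1d)).
apply: (@le_trans _ _ (\int[P]_w (L0 / 2 * (delta ^+ 2 * sqn (u s w) + 1)))%R).
  apply: le_Rintegral => //; first exact: L1_norm.
  move=> w _; apply: (le_trans (lipf _ _)); rewrite addrAC subrr add0r.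
  rewrite -mulrA ler_wpM2l ?(ltW L0_gt0)// norm2Z (gtr0_norm delta_gt0).
  rewrite -sqr_norm2 -exprMn.
  have := sqr_ge0 (delta * norm2 (u s w) - 1); rewrite sqrrB1; lra.
rewrite RintegralZl//; last first.
  by apply: L1D; [apply: L1Z; exact: L1_sqn_u|exact: L1_cst].
rewrite RintegralD//; [|by apply: L1Z; exact: L1_sqn_u|exact: L1_cst].
rewrite RintegralZl//; last exact: L1_sqn_u.
rewrite integral_sqn_u integral_cst_prob.
have := ler_wpM2l (ltW L0_gt0) dd1; lra.
Qed.

End iterates.

(** * The uniformly random iterate *)

Section uniform_time.
Context (R : realType) disp (Omega : measurableType disp)
  (P : probability Omega R) (d : nat) (u : nat -> Omega -> 'rV[R]_d).
Context (tau : {RV P >-> nat}) (T : nat).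
Hypothesis T_gt0 : (0 < T)%N.
Hypothesis unif : uniform_index T tau.
Hypothesis indep :
  independent P (preimage_set_system [set: Omega] tau measurable) (sigma_seq u).
Hypothesis mu_ : forall t, measurable_rV (u t).

(** [Omega] with the sigma-algebra of the whole noise sequence. The iterates are measurable for it
    and [tau] is independent of it, so quantities at a fixed time factor from the indicators of
    [tau]. *)
Let history := g_sigma_algebraType (\bigcup_t sigma_rV (u t)).

Let sigma_rV_measurable t : sigma_rV (u t) `<=` measurable.
Proof.
apply: smallest_sub; first exact: sigma_algebra_measurable.
elim/big_ind: _ => // [A B mA mB _ [/mA|/mB]//|j _ _ [B mB <-]].
exact: (@mu_ t j).
Qed.

Let history_id : measurable_fun setT (id : Omega -> history).
Proof.
by apply: g_sigma_id_measurable => A [t _]; exact: sigma_rV_measurable.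
Qed.

Let mtau : measurable_fun setT (tau : Omega -> nat).
Proof. exact: measurable_funP. Qed.

Lemma measurable_history s : measurable_rV (u s : history -> 'rV[R]_d).
Proof.
move=> j _ B mB; rewrite setTI; apply: sub_sigma_algebra; exists s => //.
apply: sub_sigma_algebra; rewrite (bigD1 j)//=; left.
by exists B => //; rewrite setTI.
Qed.

Let tau_history A B : measurable (A : set history) -> measurable B ->
  (P (id @^-1` A `&` tau @^-1` B) = P (id @^-1` A) * distribution P tau B)%E.
Proof.
move=> mA mB; rewrite preimage_id setIC muleC indep//.
by exists B => //; rewrite setTI.
Qed.

Let ind k w : R := \1_[set k] (tau w).

Let integral_ind k : (k < T)%N ->
  (\int[distribution P tau]_n \1_[set k] n = T%:R^-1 :> R)%R.
Proof.
move=> kT; rewrite /Rintegral integral_indic// setIT.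
by have := unif k; rewrite kT => H; exact: (congr1 fine H).
Qed.

Let L1_ind k : L1fun (distribution P tau) (\1_[set k] : nat -> R).
Proof.
apply: (@L1_le _ _ _ (distribution P tau) _ (cst 1)).
- exact: measurable_indic.
- by move=> n; rewrite indicE; case: (_ \in _); rewrite ?normr1 ?normr0.
- exact: finite_measure_integrable_cst.
Qed.

Lemma uniform_time_expectation_le (X : nat -> Omega -> R) (K : R) :
  (forall k, measurable_fun setT (X k : history -> R)) ->
  (forall k w, 0 <= X k w <= K) ->
  ('E_P[fun w => X (tau w) w] <=
    (T%:R^-1 * \sum_(k < T) (\int[P]_w X k w)%R)%:E)%E.
Proof.
move=> mX XK.
have K0 : 0 <= K by have /andP[] := XK 0%N point => /le_trans; apply.
have mX' k : measurable_fun setT (X k).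
  exact: (measurableT_comp (@mX k) history_id).
have iX k : L1fun P (X k).
  apply: (@L1_le _ _ _ P _ (cst K)) => //.
    by move=> w; have /andP[X0 XK'] := XK k w; rewrite ger0_norm.
  exact: finite_measure_integrable_cst.
have iXi k : L1fun P (fun w => X k w * ind k w).
  exact: (L1M_independent history_id mtau tau_history (@mX k) (iX k) (L1_ind k)).
have i1i k : L1fun P (fun w => 1 * ind k w).
  apply: (L1M_independent history_id mtau tau_history (X := cst 1) _ _ (L1_ind k)).
    exact: measurable_cst.
  exact: finite_measure_integrable_cst.
(* When [tau w < T], the indicators select [X (tau w) w] and the last term vanishes. That term
   equals [K] on the null event [T <= tau w], and its expectation is zero. *)
pose F w := \sum_(k < T) (X k w * ind k w) + K * (1 - \sum_(k < T) (1 * ind k w)).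
have iF : L1fun P F.
  apply: L1D; first exact: L1_sum.
  apply: L1Z; apply: L1B; last exact: L1_sum.
  exact: finite_measure_integrable_cst.
have XF w : X (tau w) w <= F w.
  rewrite /F; have [tT|Tt] := ltnP (tau w) T.
    have E (G : nat -> R) : \sum_(k < T) G k * ind k w = G (tau w).
      rewrite (bigD1 (Ordinal tT))//= /ind indicE mem_set// mulr1.
      rewrite big1 ?addr0// => k kt; rewrite indicE memNset ?mulr0//= => tk.
      by move/eqP: kt; apply; apply: val_inj; rewrite /= tk.
    by rewrite (E (fun k => X k w)) (E (fun=> 1)) subrr mulr0 addr0.
  have E (G : nat -> R) : \sum_(k < T) G k * ind k w = 0.
    apply: big1 => k _; rewrite /ind indicE memNset ?mulr0//= => tk.
    by move: Tt; rewrite tk leqNgt ltn_ord.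
  rewrite (E (fun k => X k w)) (E (fun=> 1)) subr0 mulr1 add0r.
  by have /andP[] := XK (tau w) w.
have mXtau : measurable_fun setT (fun w => X (tau w) w).
  move=> _ B mB; rewrite setTI (_ : _ @^-1` _ =
      \bigcup_k (tau @^-1` [set k] `&` X k @^-1` B)); last first.
    by apply/seteqP; split=> [w XB|w [k _ [/= -> //]]]; exists (tau w).
  apply: bigcupT_measurable => k; apply: measurableI.
    by rewrite -[X in measurable X]setTI; exact: mtau.
  by rewrite -[X in measurable X]setTI; exact: mX'.
rewrite unlock; apply: (@le_trans _ _ (\int[P]_w (F w)%:E)%E).
  apply: ge0_le_integral => //.
  - by move=> w _; rewrite lee_fin; have /andP[] := XK (tau w) w.
  - exact/measurable_EFinP.
  - exact: measurable_int iF.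
  - by move=> w _; rewrite lee_fin.
have -> : (\int[P]_w (F w)%:E = (\int[P]_w F w)%R%:E)%E.
  by rewrite /Rintegral fineK//; exact: integrable_fin_num.
rewrite lee_fin /F.
have iS1 : L1fun P (fun w => \sum_(k < T) (1 * ind k w)) by exact: L1_sum.
have iB1 : L1fun P (fun w => 1 - \sum_(k < T) (1 * ind k w)).
  by apply: L1B => //; exact: finite_measure_integrable_cst.
rewrite RintegralD//; [|exact: L1_sum|exact: L1Z].
rewrite RintegralZl// RintegralB//; last exact: finite_measure_integrable_cst.
rewrite !integral_sum_L1//.
have EX k : (k < T)%N -> forall (G : Omega -> R),
    measurable_fun setT (G : history -> R) -> L1fun P G ->
    (\int[P]_w (G w * ind k w) = (\int[P]_w G w) * T%:R^-1)%R.
  move=> kT G mG iG; rewrite -(integral_ind kT).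
  exact: (integralM_independent history_id mtau tau_history mG iG (L1_ind k)).
rewrite (eq_bigr _ (fun (k : 'I_T) _ => EX k (ltn_ord k) _ (@mX k) (iX k))).
under [X in _ - X]eq_bigr => k _.
  rewrite (EX k (ltn_ord k) (cst 1)); last 2 first.
  - exact: measurable_cst.
  - exact: finite_measure_integrable_cst.
  over.
rewrite integral_cst_prob sumr_const card_ord mul1r -[T%:R^-1 *+ T]mulr_natl.
rewrite divff ?pnatr_eq0 -?lt0n//.
by rewrite subrr mulr0 addr0 -mulr_suml mulrC.
Qed.

End uniform_time.

(** * The convergence rate *)

(** By nonnegativity, the sums on the right can be extended by one term to the same length as on the
    left, which later lets a small [alpha] be absorbed. *)
Lemma sum_recursion_le (R : realType) (M e : nat -> R) (alpha beta B : R) :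
  0 <= alpha -> 0 <= beta -> 0 <= B ->
  (forall t, 0 <= M t) -> (forall t, 0 <= e t) ->
  (forall t, M t.+1 <= alpha * M t + beta * e t + B) ->
  forall n, \sum_(t < n) M t <=
    M 0%N + alpha * \sum_(t < n) M t + beta * \sum_(t < n) e t + n%:R * B.
Proof.
move=> a0 b0 B0 M0 e0 rec; case=> [|n].
  by rewrite !big_ord0 !mulr0 mul0r !addr0.
suff H : \sum_(t < n.+1) M t <=
    M 0%N + alpha * \sum_(t < n) M t + beta * \sum_(t < n) e t + n%:R * B.
  apply: (le_trans H); rewrite ![\sum_(t < n.+1) _]big_ord_recr/= -natr1.
  have := mulr_ge0 a0 (M0 n); have := mulr_ge0 b0 (e0 n).
  rewrite !mulrDr mulrDl; lra.
elim: n => [|n IH].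
  by rewrite big_ord_recr !big_ord0/= !mulr0 mul0r !addr0 add0r.
rewrite big_ord_recr/= [in leRHS]big_ord_recr [X in beta * X]big_ord_recr/=.
rewrite -[n.+1%:R]natr1 !mulrDr mulrDl; have := rec n; lra.
Qed.

(** The final arithmetic, with [D] for the dimension, [r] for the cube root of [T], [d2] for
    [delta ^+ 2], and [S], [Q] for the sums of the expected squared norms of gradients and
    feedbacks. No root remains in these variables. *)
Lemma rate_bound (R : realType) (D r L0 L1f Lt eta d2 S Q M0 G : R) :
  1 <= D -> 1 <= r -> 0 < L0 -> 0 < L1f -> 2 * L0 <= Lt -> 32 * L1f <= Lt ->
  eta = (Lt * (D + 4) ^+ 2 * r)^-1 -> d2 = (D * r ^+ 2)^-1 ->
  0 <= S -> 0 <= Q -> 0 <= M0 -> 0 <= G ->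
  Q <= M0 + 2 * L0 ^+ 2 * eta ^+ 2 / d2 * D * Q + 32 * D ^+ 2 * S +
    r ^+ 3 * (90 * L1f ^+ 2 * d2 * D ^+ 3) ->
  eta * (3 / 4 * S - r ^+ 3 * (5 * L1f ^+ 2 * d2 * D)) <=
    G + L1f * eta ^+ 2 / 2 * Q ->
  (r ^+ 3)^-1 * S <= 5 * (25 * Lt * G + 7 * L1f ^+ 2 + M0) * D ^+ 2 * (r ^+ 2)^-1.
Proof.
move=> D1 r1 L0_gt0 L1_gt0 LtL0 LtL1 etaE d2E S0 Q0 M00 G0 hQ hS.
have Lt0 : 0 < Lt by rewrite (lt_le_trans _ LtL0)// mulr_gt0.
have D0 : 0 < D by rewrite (lt_le_trans _ D1).
have r0 : 0 < r by rewrite (lt_le_trans _ r1).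
set k := (D + 4) ^+ 2 in etaE.
have k0 : 0 < k by rewrite exprn_gt0// addr_gt0.
have kD8 : 8 * D <= k.
  by rewrite /k -subr_ge0 (_ : _ - _ = D ^+ 2 + 16) ?addr_ge0 ?sqr_ge0//; ring.
have kDD : D ^+ 2 <= k.
  rewrite /k -subr_ge0 (_ : _ - _ = 8 * D + 16); last by ring.
  by rewrite addr_ge0// mulr_ge0// ltW.
have k25 : k <= 25 * D ^+ 2.
  rewrite /k -subr_ge0 (_ : _ - _ = 8 * (D - 1) * (3 * D + 2)); last by ring.
  by rewrite mulr_ge0 ?mulr_ge0 ?subr_ge0// addr_ge0// mulr_ge0// ltW.
clearbody k.
have eta0 : 0 < eta by rewrite etaE invr_gt0 (mulr_gt0 (mulr_gt0 Lt0 k0) r0).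
have alphaE : 2 * L0 ^+ 2 * eta ^+ 2 / d2 * D =
    2 * (L0 / Lt) ^+ 2 * (D / k) ^+ 2.
  by rewrite etaE d2E; field; rewrite !gt_eqF.
(* From [L0 / Lt <= 1 / 2] and [D / k <= 1 / 8]: two times one quarter times one sixty-fourth. *)
have alpha_le : 2 * L0 ^+ 2 * eta ^+ 2 / d2 * D <= 128^-1.
  rewrite alphaE.
  have h1 : (L0 / Lt) ^+ 2 <= (2^-1) ^+ 2.
    have a0 : 0 <= L0 / Lt by rewrite divr_ge0// ltW.
    have a1 : L0 / Lt <= 2^-1 by rewrite ler_pdivrMr//; lra.
    by rewrite lerXn2r// nnegrE invr_ge0.
  have h2 : (D / k) ^+ 2 <= (8^-1) ^+ 2.
    have a0 : 0 <= D / k by rewrite divr_ge0// ltW.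
    have a1 : D / k <= 8^-1 by rewrite ler_pdivrMr//; lra.
    by rewrite lerXn2r// nnegrE invr_ge0.
  apply: (@le_trans _ _ (2 * (2^-1) ^+ 2 * (8^-1) ^+ 2)); last by lra.
  apply: ler_pM => //; first by rewrite mulr_ge0// sqr_ge0.
    exact: sqr_ge0.
  exact: ler_wpM2l.
have noiseE : r ^+ 3 * (90 * L1f ^+ 2 * d2 * D ^+ 3) =
    90 * L1f ^+ 2 * D ^+ 2 * r.
  by rewrite d2E; field; rewrite !gt_eqF.
have hQ' : 127 / 128 * Q <= M0 + 32 * D ^+ 2 * S + 90 * L1f ^+ 2 * D ^+ 2 * r.
  have := ler_wpM2r Q0 alpha_le; move: hQ; rewrite noiseE.
  set A := _ / d2 * D * Q; lra.
have biasE : r ^+ 3 * (5 * L1f ^+ 2 * d2 * D) = 5 * L1f ^+ 2 * r.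
  by rewrite d2E; field; rewrite !gt_eqF.
have hS' : 3 / 4 * S - 5 * L1f ^+ 2 * r <= G / eta + L1f * eta / 2 * Q.
  rewrite -(ler_pM2l eta0) -biasE; apply: (le_trans hS).
  by rewrite le_eqVlt; apply/orP; left; apply/eqP; field; rewrite gt_eqF.
(* Here [32 * L1f <= Lt] and [D ^+ 2 <= k] are used; the latter cancels the factor [D ^+ 2] in front
   of [S] in [hQ']. *)
have step : L1f * eta / 2 * Q <= (64 * D ^+ 2 * r)^-1 * Q.
  rewrite ler_wpM2r// etaE.
  have -> : L1f * (Lt * k * r)^-1 / 2 = (2 * (Lt / L1f) * k * r)^-1.
    by field; rewrite !gt_eqF.
  rewrite lef_pV2 ?posrE ?mulr_gt0 ?invr_gt0 ?exprn_gt0//.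
  rewrite ler_wpM2r ?(ltW r0)// ler_pM ?sqr_ge0//.
  have : 32 <= Lt / L1f by rewrite ler_pdivlMr.
  lra.
(* [2 / 127] is [128 / 127] divided by [64]. The resulting coefficient of [S] is [64 / 127], below
   the [3 / 4] available in [hS']. *)
have step2 : (64 * D ^+ 2 * r)^-1 * Q <=
    2 / 127 * (M0 + 32 * S + 90 * L1f ^+ 2).
  have Dr : 1 <= D ^+ 2 * r by rewrite mulr_ege1// exprn_ege1.
  rewrite mulrC ler_pdivrMr ?mulr_gt0 ?exprn_gt0//.
  have h1 : M0 <= M0 * (D ^+ 2 * r) by rewrite ler_peMr.
  have h2 : D ^+ 2 * S <= D ^+ 2 * S * r.
    by rewrite ler_peMr// mulr_ge0// sqr_ge0.
  have -> : 2 / 127 * (M0 + 32 * S + 90 * L1f ^+ 2) * (64 * D ^+ 2 * r) =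
     128 / 127 * (M0 * (D ^+ 2 * r) + 32 * (D ^+ 2 * S * r) +
       90 * L1f ^+ 2 * D ^+ 2 * r) by ring.
  set A := M0 * _ in h1 *; set B := D ^+ 2 * S * r in h2 *.
  move: hQ'; rewrite -[32 * D ^+ 2 * S]mulrA.
  set A' := D ^+ 2 * S in h2 *; set E := 90 * _ * _ * r; lra.
have GE : G / eta <= 25 * Lt * G * D ^+ 2 * r.
  rewrite etaE invrK.
  have -> : 25 * Lt * G * D ^+ 2 * r = G * (Lt * (25 * D ^+ 2) * r) by ring.
  by rewrite ler_wpM2l// ler_wpM2r ?(ltW r0)// ler_wpM2l// ltW.
(* The coefficient of [S] left after absorption, [3 / 4 - 64 / 127], exceeds [1 / 5]; the constant
   [7] covers [5 + 180 / 127]. *)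
have fin : S <= 5 * (25 * Lt * G + 7 * L1f ^+ 2 + M0) * D ^+ 2 * r.
  have DD1 : 1 <= D ^+ 2 by rewrite exprn_ege1.
  have Dr : 1 <= D ^+ 2 * r by rewrite mulr_ege1.
  have LL : 0 <= L1f ^+ 2 by exact: sqr_ge0.
  have h1 : M0 <= M0 * (D ^+ 2 * r) by rewrite ler_peMr.
  have h2 : L1f ^+ 2 <= L1f ^+ 2 * (D ^+ 2 * r) by rewrite ler_peMr.
  have h3 : L1f ^+ 2 * r <= L1f ^+ 2 * (D ^+ 2 * r).
    by rewrite ler_wpM2l// ler_peMl// ltW.
  have -> : 5 * (25 * Lt * G + 7 * L1f ^+ 2 + M0) * D ^+ 2 * r =
    5 * (25 * Lt * G * D ^+ 2 * r) + 35 * (L1f ^+ 2 * (D ^+ 2 * r)) +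
    5 * (M0 * (D ^+ 2 * r)) by ring.
  move: hS' step step2 GE h1 h2 h3.
  rewrite -[5 * L1f ^+ 2 * r]mulrA.
  set a1 := G / eta; set a2 := _ * Q; set a3 := _^-1 * Q.
  set a4 := 25 * Lt * G * D ^+ 2 * r; set a5 := L1f ^+ 2 * (D ^+ 2 * r).
  set a6 := M0 * (D ^+ 2 * r); set a7 := L1f ^+ 2 * r; set a8 := L1f ^+ 2.
  move: LL; rewrite -/a8; lra.
rewrite mulrC ler_pdivrMr ?exprn_gt0//; apply: (le_trans fin).
by rewrite le_eqVlt; apply/orP; left; apply/eqP; field; rewrite gt_eqF.
Qed.

Theorem theorem8 (R : realType) :
  exists C : R -> R -> R -> R -> R,
  forall (d T : nat) (L0 L1 : R) (f : 'rV[R]_d -> R) (x0 : 'rV[R]_d)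
    (disp : measure_display) (Omega : measurableType disp)
    (P : probability Omega R)
    (u x : nat -> Omega -> 'rV[R]_d) (tau : {RV P >-> nat}),
  let Lt : R := Num.max (2 * L0) (32 * L1) in
  let eta : R := (Lt * (d%:R + 4) ^+ 2 * T%:R `^ (1 / 3))^-1 in
  let delta : R := (Num.sqrt d%:R * T%:R `^ (1 / 3))^-1 in
  let f_delta := smoothed P (u 0%N) f delta in
  let gap : R := f_delta x0 - inf (range f_delta) in
  let g0 : R := fine 'E_P[fun w => norm2 (residual_feedback f delta u x 0%N w) ^+ 2] in
  (0 < d)%N -> (1 <= T)%N -> 0 < L0 -> 0 < L1 ->
  (exists m : R, forall y, m <= f y) ->
  (forall y z, `|f y - f z| <= L0 * norm2 (y - z)) ->
  (forall y, differentiable f y) ->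
  (forall y z, norm2 (gradient f y - gradient f z) <= L1 * norm2 (y - z)) ->
  iid_standard_gaussian P u ->
  residual_feedback_iterates f eta delta x0 u x ->
  uniform_index T tau ->
  independent P (preimage_set_system [set: Omega] tau measurable) (sigma_seq u) ->
  ('E_P[fun w => (norm2 (gradient f (x (tau w) w)) ^+ 2)%R]
    <= (C L0 L1 gap g0 * d%:R ^+ 2 * T%:R `^ (- (2 / 3)))%R%:E)%E.
Proof.
(* The summand [3 * L0] pays for three uses of [smoothing_gap]: two to pass from [u T] to [u 0] at
   [x0] through [f x0], and one to bound [f] below by the infimum of [f_delta]. *)
exists (fun L0 L1 gap g0 =>
  5 * (25 * Num.max (2 * L0) (32 * L1) * (gap + 3 * L0) + 7 * L1 ^+ 2 + g0)).
move=> d T L0 L1f f x0 disp Omega P u x tau Lt eta delta f_delta gap g0.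
move=> d_gt0 T_gt0 L0_gt0 L1_gt0 [m fm] lipf df lipdf iid itx unif indep.
pose D : R := d%:R; pose r : R := T%:R `^ (1 / 3).
have D1 : 1 <= D by rewrite ler1n.
have D0 : 0 < D by rewrite (lt_le_trans _ D1).
have D_ge0 := ltW D0.
have L0_ge0 := ltW L0_gt0.
have L1_ge0 := ltW L1_gt0.
have r3 : r ^+ 3 = T%:R.
  rewrite -powR_mulrn ?powR_ge0// -powRrM (_ : 1 / 3 * 3%:R = 1) ?powRr1//.
  by rewrite mul1r mulVf.
have r1 : 1 <= r.
  by rewrite -(powRr0 T%:R) ler_powR ?ler1n// divr_ge0.
have r0 : 0 < r by rewrite (lt_le_trans _ r1).
have r2 : T%:R `^ (- (2 / 3)) = (r ^+ 2)^-1.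
  by rewrite powRN -powR_mulrn ?powR_ge0// -powRrM; congr (_ `^ _)^-1; field.
have LtL0 : 2 * L0 <= Lt by rewrite le_max lexx.
have LtL1 : 32 * L1f <= Lt by rewrite le_max lexx orbT.
have Lt0 : 0 < Lt by rewrite (lt_le_trans _ LtL0)// mulr_gt0.
have eta0 : 0 <= eta.
  by rewrite invr_ge0 !mulr_ge0 ?powR_ge0 ?sqr_ge0// ltW.
have delta0 : 0 < delta by rewrite invr_gt0 mulr_gt0 ?sqrtr_gt0.
have delta2 : delta ^+ 2 = (D * r ^+ 2)^-1.
  by rewrite /delta exprVn exprMn sqr_sqrtr// ltW.
have deltaD : delta ^+ 2 * D <= 1.
  rewrite delta2 mulrC ler_pdivrMr ?mulr_gt0 ?exprn_gt0// mul1r.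
  by rewrite ler_peMr ?exprn_ege1// ltW.
have f_deltaE y : f_delta y = (\int[P]_w f (y + delta *: u 0%N w))%R.
  by rewrite /f_delta /smoothed unlock.
have smooth s y := smoothing_gap L0_gt0 lipf iid delta0 s y deltaD.
have f_delta_lb y : m <= f_delta y.
  rewrite f_deltaE -(integral_cst_prob P m); apply: le_Rintegral => //.
  - exact: L1_cst.
  - exact: (L1_query_le L0_gt0 lipf iid delta0 0 (@measurable_rV_cst _ _ _ _ y)
      (L1_cst P (f y))).
have lbE : has_lbound (range f_delta).
  by exists m => _ [y _ <-]; exact: f_delta_lb.
(* A lower bound of [f] expressed through [f_delta], so that the final constant does not depend on
   [m]. *)
pose m' := inf (range f_delta) - L0.
have fm' y : m' <= f y.
  have h1 : inf (range f_delta) <= f_delta y by apply: ge_inf => //; exists y.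
  have := smooth 0%N y; rewrite -f_deltaE ler_norml /m' => /andP[]; lra.
pose M t := (\int[P]_w sqn (residual_feedback f delta u x t w))%R.
pose e t := (\int[P]_w sqn (gradient f (x t w)))%R.
have g0E : g0 = M 0%N.
  rewrite /g0 unlock /M /Rintegral; congr fine; apply: eq_integral => w _.
  by rewrite sqr_norm2.
have M0 t : 0 <= M t by apply: Rintegral_ge0 => w _; exact: sqn_ge0.
have e0 t : 0 <= e t by apply: Rintegral_ge0 => w _; exact: sqn_ge0.
pose S := \sum_(t < T) e t; pose Q := \sum_(t < T) M t.
have S0 : 0 <= S by exact: sumr_ge0.
have Q0 : 0 <= Q by exact: sumr_ge0.
have G0 : 0 <= gap + 3 * L0.
  have : 0 <= gap by rewrite /gap subr_ge0; apply: ge_inf => //; exists x0.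
  lra.
have delta_ge0 := ltW delta0.
have hQ : Q <= M 0%N + 2 * L0 ^+ 2 * eta ^+ 2 / delta ^+ 2 * D * Q +
    32 * D ^+ 2 * S + r ^+ 3 * (90 * L1f ^+ 2 * delta ^+ 2 * D ^+ 3).
  rewrite r3; apply: sum_recursion_le => //.
  - apply: mulr_ge0 => //; apply: divr_ge0; last exact: sqr_ge0.
    by apply: mulr_ge0; [apply: mulr_ge0 => //|]; exact: sqr_ge0.
  - by rewrite mulr_ge0 ?sqr_ge0.
  - apply: mulr_ge0; last exact: exprn_ge0.
    by apply: mulr_ge0; [apply: mulr_ge0 => //|]; exact: sqr_ge0.
  - exact: (integral_sqn_feedbackS_le L0_gt0 L1_gt0 lipf df lipdf iid itx delta0).
have hS : eta * (3 / 4 * S - r ^+ 3 * (5 * L1f ^+ 2 * delta ^+ 2 * D)) <=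
    gap + 3 * L0 + L1f * eta ^+ 2 / 2 * Q.
  have := descent_sum L0_gt0 L1_gt0 lipf df lipdf iid itx eta0 delta0 (leqnn T).
  rewrite sumrB -mulr_sumr sumr_const card_ord -[_ *+ T]mulr_natl -r3.
  rewrite -/Q -/S => H.
  have mxT : measurable_rV (x T).
    by apply: (measurable_iterates lipf itx) => s _ i;
      exact: (gaussian_coord_measurable iid s i).
  have L1_last := L1_query_le L0_gt0 lipf iid delta0 T mxT
    (L1_iterates L0_gt0 L1_gt0 lipf df lipdf iid itx eta0 delta0 T).
  have h1 : m' <= (\int[P]_w f (x T w + delta *: u T w))%R.
    rewrite -(integral_cst_prob P m'); apply: le_Rintegral => //.
    exact: L1_cst.
  have := smooth T x0; have := smooth 0%N x0.
  rewrite -f_deltaE !ler_norml => /andP[h2 _] /andP[_ h3].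
  move: H h1; rewrite /gap /m'; lra.
apply: (@le_trans _ _ (T%:R^-1 * S)%:E); last first.
  rewrite lee_fin r2 g0E -r3.
  exact: (rate_bound D1 r1 L0_gt0 L1_gt0 LtL0 LtL1 erefl delta2 S0 Q0 (M0 0%N)
    G0 hQ hS).
under eq_fun do rewrite sqr_norm2.
have mu_ t : measurable_rV (u t).
  by move=> i; exact: (gaussian_coord_measurable iid t i).
apply: (@uniform_time_expectation_le _ _ _ P d u tau T T_gt0 unif indep mu_
  (fun k w => sqn (gradient f (x k w))) (D * (L0 + L1f / 2) ^+ 2)).
- move=> k.
  pose history := g_sigma_algebraType (\bigcup_t sigma_rV (u t)).
  have mxk : measurable_rV (x k : history -> 'rV[R]_d).
    apply: (measurable_iterates lipf (Omega := history) itx) => s _.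
    exact: measurable_history.
  have mg := measurable_grad_comp lipdf mxk.
  exact: measurable_dot.
- by move=> k w; rewrite sqn_ge0 (sqn_grad_le L0_gt0 L1_gt0 lipf df lipdf).
Qed.
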